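(* Let $m,n\ge 2$ be integers and $r\in\mathbb{Z}_n$. The graph $\mathrm{Qd}(m,n,r)$ is nontrivially unstable if and only if it is (as a graph, up to isomorphism) one of the following, where the letters $m,k,\ell$ in the list denote new integer parameters with $m,k\ge 1$, such that the first two arguments of each graph are $\ge 2$: (1) $\mathrm{Qd}(m,4k,\pm k)$, where $m+k$ is odd; or (2) $\mathrm{Qd}(2m,km,\pm 4\ell m)$ (which is isomorphic to $\mathrm{Qd}(m,2km,\pm 2\ell m)$ if $m>1$), where $m$ is odd, $4\ell^2\equiv \pm 1 \pmod{k}$, and either $m>1$ or $2\ell\not\equiv\pm 1\pmod{k}$.
   Context: All graphs are simple (no loops or multiple edges). Definition of $\mathrm{Qd}(m,n,r)$: for integers $m,n\ge 2$ and $r\in\mathbb{Z}_n$ (so $r$ is taken modulo $n$), number the vertices of the cycle $C_n$ with the elements of $\mathbb{Z}_n$ in cyclic order (with the convention $C_2=K_2$), and the vertices of the path $P_{m+1}$ with $0,1,\dots,m$ in order. Then $\mathrm{Qd}(m,n,r)$ is the graph obtained from the Cartesian product of $C_n$ and $P_{m+1}$ by identifying the vertex $(x,m)$ with $(x+r,0)$ for each $x\in\mathbb{Z}_n$ (any resulting multiple edges are merged). The canonical bipartite double cover of a graph $X$ is the graph $BX$ with vertex set $V(X)\times\{0,1\}$ in which $(v,0)$ is adjacent to $(w,1)$ if and only if $v$ is adjacent to $w$ in $X$ (and there are no other edges). The group $\mathrm{Aut}\,X\times S_2$, where $S_2$ is the symmetric group on $\{0,1\}$, is naturally a subgroup of $\mathrm{Aut}\,BX$.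 The graph $X$ is stable if $\mathrm{Aut}\,BX=\mathrm{Aut}\,X\times S_2$, and unstable otherwise. Twin vertices are two different vertices with the same set of neighbours. An unstable graph is nontrivially unstable if it is connected, nonbipartite, and has no twin vertices. *)

(* Defs.v *)
From mathcomp Require Import all_boot all_order all_algebra all_fingroup.

Set Implicit Arguments.
Unset Strict Implicit.
Unset Printing Implicit Defensive.

Import GRing.Theory.

Record sgraph := SGraph {
  vertex :> finType;
  edge : rel vertex;
  edge_sym : symmetric edge;
  edge_irrefl : irreflexive edge
}.

Definition isomorphic (X Y : sgraph) : Prop :=
  exists2 f : X -> Y, bijective f & forall u v : X, edge (f u) (f v) = edge u v.

Definition graph_aut (X : sgraph) : {set {perm X}} :=
  [set s : {perm X} | [forall u : X, forall v : X, edge (s u) (s v) == edge u v]].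

Definition graph_connected (X : sgraph) : Prop :=
  forall u v : X, connect (@edge X) u v.

Definition bipartite (X : sgraph) : Prop :=
  exists c : X -> bool, forall u v : X, edge u v -> c u != c v.

Definition twins (X : sgraph) (u v : X) : Prop := u <> v /\ edge u =1 edge v.

(* The elements 0, 1 of {0,1} are encoded as false, true. *)
Section DoubleCover.
Variable X : sgraph.

Definition double_cover_edge : rel (X * bool) :=
  fun u v => (u.2 != v.2) && edge u.1 v.1.

Lemma double_cover_sym : symmetric double_cover_edge.
Proof. by move=> u v; rewrite /double_cover_edge eq_sym edge_sym. Qed.

Lemma double_cover_irrefl : irreflexive double_cover_edge.
Proof. by move=> u; rewrite /double_cover_edge eqxx. Qed.

Definition double_cover : sgraph :=
  SGraph double_cover_sym double_cover_irrefl.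

End DoubleCover.

Section PairPerm.
Variables (S T : finType) (s : {perm S}) (t : {perm T}).

Lemma pair_perm_subproof : injective (fun u : S * T => (s u.1, t u.2)).
Proof. by move=> [a b] [c d] /= [/perm_inj -> /perm_inj ->]. Qed.

Definition pair_perm : {perm S * T} := perm pair_perm_subproof.

End PairPerm.

(* Aut X x S_2 as a subset of Aut BX. *)
Definition aut_times_S2 (X : sgraph) : {set {perm X * bool}} :=
  [set pair_perm s t | s in graph_aut X, t in [set: {perm bool}]].

Definition stable (X : sgraph) : Prop :=
  graph_aut (double_cover X) = aut_times_S2 X.

Definition nontrivially_unstable (X : sgraph) : Prop :=
  [/\ ~ stable X, graph_connected X, ~ bipartite X
    & ~ exists u v : X, twins u v].

Section CartesianProduct.
Variables X Y : sgraph.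

Definition cartesian_edge : rel (X * Y) :=
  fun u v => (u.1 == v.1) && edge u.2 v.2 || (u.2 == v.2) && edge u.1 v.1.

Lemma cartesian_sym : symmetric cartesian_edge.
Proof.
move=> u v; rewrite /cartesian_edge (eq_sym u.1) (eq_sym u.2).
by rewrite (edge_sym u.1) (edge_sym u.2).
Qed.

Lemma cartesian_irrefl : irreflexive cartesian_edge.
Proof. by move=> u; rewrite /cartesian_edge !edge_irrefl !andbF. Qed.

Definition cartesian_product : sgraph :=
  SGraph cartesian_sym cartesian_irrefl.

End CartesianProduct.

(* For n = 2 this is K_2. *)
Section Cycle.
Variable n : nat.

Definition cycle_edge : rel 'Z_n :=
  fun x y => (y == x + 1)%R || (x == y + 1)%R.

Lemma cycle_sym : symmetric cycle_edge.
Proof. by move=> x y; rewrite /cycle_edge orbC. Qed.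

Lemma cycle_irrefl : irreflexive cycle_edge.
Proof.
move=> x; rewrite /cycle_edge orbb -subr_eq0 opprD addrA subrr sub0r.
by rewrite oppr_eq0 oner_eq0.
Qed.

Definition cycle_graph : sgraph := SGraph cycle_sym cycle_irrefl.

End Cycle.

(* The path on the m + 1 vertices 0, ..., m, written P_{m+1} in the usual
   notation. *)
Section Path.
Variable m : nat.

Definition path_edge : rel 'I_m.+1 :=
  fun i j => (j == i.+1 :> nat) || (i == j.+1 :> nat).

Lemma path_edge_sym : symmetric path_edge.
Proof. by move=> i j; rewrite /path_edge orbC. Qed.

Lemma path_edge_irrefl : irreflexive path_edge.
Proof. by move=> i; rewrite /path_edge orbb (ltn_eqF (ltnSn i)). Qed.

Definition path_graph : sgraph := SGraph path_edge_sym path_edge_irrefl.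

End Path.

(* The graph obtained from X by identifying the vertices with the same image
   under f.  Multiple edges are merged since [edge] is a relation; loops are
   dropped, but none arise in Qd(m,n,r) with m, n >= 2 (lemma [Qd_no_loops]). *)
Section Quotient.
Variables (X : sgraph) (T : finType) (f : X -> T).

Definition quotient_edge : rel T :=
  fun u v => (u != v) &&
    [exists a : X, exists b : X, [&& f a == u, f b == v & edge a b]].

Lemma quotient_sym : symmetric quotient_edge.
Proof.
move=> u v; rewrite /quotient_edge eq_sym; congr (_ && _).
by apply/existsP/existsP => -[a /existsP[b /and3P[fa fb eab]]];
  exists b; apply/existsP; exists a; rewrite fa fb edge_sym.
Qed.

Lemma quotient_irrefl : irreflexive quotient_edge.
Proof. by move=> u; rewrite /quotient_edge eqxx. Qed.

Definition quotient_graph : sgraph := SGraph quotient_sym quotient_irrefl.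

End Quotient.

(* Sends (x,m) to (x+r,0) and is the identity on the other vertices, the second
   coordinate being read in {0,...,m-1} = Z_m. The lemmas [Qd_glueP] and
   [Qd_glue_surj] show that its fibres are exactly the classes of the
   identification (x,m) ~ (x+r,0).  As 'Z_n is Z/2 when n < 2, this is only
   meaningful for m, n >= 2. *)
Definition Qd_glue (m n : nat) (r : 'Z_n) (u : 'Z_n * 'I_m.+1) :
    'Z_n * 'Z_m :=
  (if u.2 == m :> nat then (u.1 + r)%R else u.1, inZp u.2).

Definition Qd (m n : nat) (r : 'Z_n) : sgraph :=
  @quotient_graph (cartesian_product (cycle_graph n) (path_graph m))
    ('Z_n * 'Z_m)%type (@Qd_glue m n r).

Lemma Qd_glueP (m n : nat) (r x y : 'Z_n) (i j : 'I_m.+1) : 1 < m ->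
  Qd_glue r (x, i) = Qd_glue r (y, j) <->
  [\/ (x, i) = (y, j),
      [/\ i = m :> nat, j = 0 :> nat & y = (x + r)%R]
    | [/\ j = m :> nat, i = 0 :> nat & x = (y + r)%R]].
Proof.
move=> m_gt1; have m_gt0 := ltnW m_gt1.
have modE (k : 'I_m.+1) :
    nat_of_ord (inZp k : 'Z_m) = if k == m :> nat then 0 else k.
  rewrite /= Zp_cast //; have := ltn_ord k; rewrite ltnS leq_eqVlt.
  by case: eqP => [-> _|_ /= /modn_small //]; rewrite modnn.
split; last first.
  case=> [[-> ->] //|[im j0 ->]|[jm i0 ->]]; rewrite /Qd_glue /=.
    rewrite im j0 eqxx [0 == m]ltn_eqF //; congr (_, _).
    by apply: val_inj; rewrite /= mod0n Zp_cast ?modnn.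
  rewrite jm i0 eqxx [0 == m]ltn_eqF //; congr (_, _).
  by apply: val_inj; rewrite /= mod0n Zp_cast ?modnn.
move=> uv; have xy := congr1 fst uv; have ij := congr1 (fun u => nat_of_ord u.2) uv.
move: xy ij; rewrite /Qd_glue [fst _]/= [fst _]/= [snd _]/= [snd _]/= !modE.
case: eqP => [im|_]; case: eqP => [jm|_] xy ij.
- by move/addIr: xy => ->; constructor 1; congr (_, _); apply: val_inj; rewrite /= im jm.
- by constructor 2.
- by constructor 3.
- by constructor 1; rewrite xy; congr (_, _); apply: val_inj.
Qed.

Lemma Qd_glue_surj (m n : nat) (r : 'Z_n) (v : 'Z_n * 'Z_m) : 1 < m ->
  exists u, Qd_glue r u = v.
Proof.
case: v => x i m_gt1; have im : i < m by rewrite -[X in _ < X](Zp_cast m_gt1).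
exists (x, widen_ord (leqnSn m) (Ordinal im)); rewrite /Qd_glue /= ltn_eqF //.
by congr (_, _); rewrite valZpK.
Qed.

Lemma Qd_no_loops (m n : nat) (r : 'Z_n) (u v : 'Z_n * 'I_m.+1) :
  1 < m -> @edge (cartesian_product (cycle_graph n) (path_graph m)) u v ->
  Qd_glue r u != Qd_glue r v.
Proof.
case: u v => [x i] [y j] m_gt1 uv.
apply/eqP => /(Qd_glueP _ _ _ _ _ m_gt1) [uvE|[im j0 _]|[jm i0 _]].
- by rewrite uvE edge_irrefl in uv.
- case/orP: uv => /andP[/eqP /= E]; last by rewrite -im E j0 in m_gt1.
  by rewrite /path_edge im j0 orFb => /eqP mE; rewrite mE in m_gt1.
- case/orP: uv => /andP[/eqP /= E]; last by rewrite -jm -E i0 in m_gt1.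
  by rewrite /path_edge jm i0 orbF => /eqP mE; rewrite mE in m_gt1.
Qed.

(* Main.v *)
Require Import Defs.
From HB Require Import structures.
From mathcomp Require Import all_boot all_order all_algebra all_fingroup.
From mathcomp Require Import zify ring.

(* Qd(m,n,r) is the Cayley graph Cay(G, {±a, ±b}) of the abelian group
   G = <a, b | n a = 0, m b = r a>.  A connected nonbipartite graph is unstable
   iff it has two distinct permutations f_0, f_1 of its vertices with
   f_0 u ~ f_1 v <-> u ~ v.  If x is the only common neighbour of x + a and x - a,
   and likewise for b, then common neighbours force
   f_{1-e}(x + a) = f_e x + A and f_{1-e}(x + b) = f_e x + B with constants A, B such
   that {±A, ±B} = {±a, ±b}; the even relations p a + q b = 0 must then be preserved
   by (a, b) -> (A, B) and some odd relation must not be, which is arithmetic in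
   m, n, r: A = ±a gives family (1), A = ±b gives family (2).  Otherwise 4 a = 0,
   4 b = 0 or 3 b = ±a, and without twins f_e still preserves the lines
   {x + k a} and {x + k b} up to sign (or the graph is K_4), whence f_0 = f_1
   unless n = 4 and r = ±1, which is in family (1).  Conversely the signed
   permutations (a, b) -> (-a, b) and (a, b) -> (b, ±a) give f_0 <> f_1 for the two
   families. *)

Set Implicit Arguments.
Unset Strict Implicit.
Unset Printing Implicit Defensive.

Import GRing.Theory Num.Theory.

Local Open Scope ring_scope.

(** * Equations in abelian groups *)

(** A relation p a + q b = 0 with p + q even is a closed walk in the double cover, so it survives
    (a, b) -> (A, B). One with p + q odd links the two layers: it only yields 2 (p A + q B) = 0, and
    p A + q B = 0 would give f_0 0 = f_1 0 and hence f_0 = f_1. This factor 2 is the source of the 4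
    k in family (1), where n divides 4 r but not 2 r. In family (2) the exchange of a and b has
    square ±1, whereas m b = r a makes it act on suitable multiples of a as multiplication by some s
    congruent to 2 l; hence 4 l^2 = ±1 modulo k. The roles of a and b differ: G maps onto Z_m with a
    in degree 0 and b in degree 1, so b is never a multiple of a, while a may be one of b. This is
    why 3 b = ±a has to be treated but 3 a = ±b does not. If 2 b = 2 a or 2 b = -2 a, translation by
    b - a or b + a preserves all neighbourhoods, so twin-freeness enters as the negation of these
    two equations. *)

Inductive zmod_expr :=
| ZVar of nat | ZZero | ZOpp of zmod_expr | ZAdd of zmod_expr & zmod_expr
| ZScale of zmod_expr & int.

Fixpoint zmod_eval (G : zmodType) (env : seq G) (e : zmod_expr) : G :=
  match e with
  | ZVar i => env`_i
  | ZZero => 0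
  | ZOpp e1 => - zmod_eval env e1
  | ZAdd e1 e2 => zmod_eval env e1 + zmod_eval env e2
  | ZScale e1 k => zmod_eval env e1 *~ k
  end.

Fixpoint zmod_coef (e : zmod_expr) (i : nat) : int :=
  match e with
  | ZVar j => if eqn i j then 1 else 0
  | ZZero => 0
  | ZOpp e1 => - zmod_coef e1 i
  | ZAdd e1 e2 => zmod_coef e1 i + zmod_coef e2 i
  | ZScale e1 k => zmod_coef e1 i * k
  end.

Lemma zmod_evalE (G : zmodType) (env : seq G) e :
  zmod_eval env e = \sum_(i < size env) env`_i *~ zmod_coef e i.
Proof.
elim: e => [j||e IH|e1 IH1 e2 IH2|e IH k] /=.
- have [jlt|jge] := ltnP j (size env).
    rewrite (bigD1 (Ordinal jlt)) //= [eqn j j]eqxx mulr1z big1 ?addr0 // => i.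
    rewrite -val_eqE /= => ij; suff -> : eqn i j = false by rewrite mulr0z.
    exact: negbTE.
  rewrite nth_default // big1 // => i _; suff -> : eqn i j = false by rewrite mulr0z.
  by apply/negbTE/eqP => ij; move: (ltn_ord i); rewrite ij ltnNge jge.
- by rewrite big1 // => i _; rewrite mulr0z.
- by rewrite IH -sumrN; apply: eq_bigr => i _; rewrite mulrNz.
- by rewrite IH1 IH2 -big_split; apply: eq_bigr => i _; rewrite mulrzDr.
- by rewrite IH mulrz_suml; apply: eq_bigr => i _; rewrite mulrzA.
Qed.

(** The hypothesis unfolds to one integer equation per atom, which lets [abel] handle symbolic
    multiplicities through [ring] or [lia]. *)
Lemma zmod_eval_eq (G : zmodType) (env : seq G) e1 e2 :
  foldr (fun i P => zmod_coef e1 i = zmod_coef e2 i /\ P) True (iota 0 (size env)) ->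
  zmod_eval env e1 = zmod_eval env e2.
Proof.
rewrite !zmod_evalE => H; apply: eq_bigr => i _; congr (_ *~ _).
suff /(_ i) : forall j, j \in iota 0 (size env) -> zmod_coef e1 j = zmod_coef e2 j.
  by apply; rewrite mem_iota /=.
elim: (iota _ _) H => //= k s IH [Hk Hs] j; rewrite inE => /orP[/eqP -> //|].
exact: IH.
Qed.

(* Atoms are compared up to conversion: occurrences of the same element may
   carry different canonical instances. *)
Ltac zmod_atom x env :=
  match env with
  | ?y :: _ => let _ := match constr:(tt) with _ => unify x y end in constr:(0%N)
  | _ :: ?env' => let i := zmod_atom x env' in constr:(i.+1)
  end.

Ltac zmod_collect t env :=
  lazymatch t with
  | (?x + ?y)%R => let env1 := zmod_collect x env in zmod_collect y env1
  | (- ?x)%R => zmod_collect x env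
  | (?x *~ ?k)%R => zmod_collect x env
  | (?x *+ ?k)%R => zmod_collect x env
  | 0%R => env
  | _ => match constr:(tt) with
         | _ => let _ := zmod_atom t env in env
         | _ => constr:(t :: env)
         end
  end.

Ltac zmod_reify t env :=
  lazymatch t with
  | (?x + ?y)%R => let u := zmod_reify x env in let v := zmod_reify y env in
                   constr:(ZAdd u v)
  | (- ?x)%R => let u := zmod_reify x env in constr:(ZOpp u)
  | (?x *~ ?k)%R => let u := zmod_reify x env in constr:(ZScale u k)
  | (?x *+ ?k)%R => let u := zmod_reify x env in constr:(ZScale u (Posz k))
  | 0%R => constr:(ZZero)
  | _ => let i := zmod_atom t env in constr:(ZVar i)
  end.

Ltac abel :=
  lazymatch goal with
  | |- @eq ?T ?x ?y =>
    let env0 := constr:(@nil T) in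
    let env1 := zmod_collect x env0 in
    let env := zmod_collect y env1 in
    let u := zmod_reify x env in
    let v := zmod_reify y env in
    refine (@zmod_eval_eq _ env u v _);
    cbn [foldr iota size zmod_coef eqn];
    repeat (split; [first [ring | lia] | ]); exact: I
  end.

Lemma eq_of_subr (G : zmodType) (u v x y : G) : u = v -> x - y = u - v -> x = y.
Proof. by move=> -> /eqP; rewrite subrr subr_eq0 => /eqP. Qed.

(* Closes x = y when x - y normalises to u - v or v - u, where E : u = v. *)
Ltac abel_from E :=
  first [apply: (eq_of_subr E); abel | apply: (eq_of_subr (esym E)); abel].

(** * Common neighbours in Cay(G, ±a, ±b) *)

Definition steps (G : zmodType) (a b : G) : seq G := [:: a; - a; b; - b].

Section Steps.
Variables (G : zmodType) (a b : G).
Notation S := (steps a b).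

Lemma stepsP s : s \in S -> [\/ s = a, s = - a, s = b | s = - b].
Proof.
rewrite !inE => /or4P[] /eqP ->;
  by [constructor 1|constructor 2|constructor 3|constructor 4].
Qed.

Lemma steps_opp s : (- s \in S) = (s \in S).
Proof.
rewrite !inE !eqr_opp !eqr_oppLR.
by case: (s == a); case: (s == - a); case: (s == b); case: (s == - b).
Qed.

Lemma steps_swap : steps b a =i S.
Proof.
move=> s; rewrite !inE.
by case: (s == a); case: (s == - a); case: (s == b); case: (s == - b).
Qed.

Lemma mem_steps_l : a \in S. Proof. by rewrite inE eqxx. Qed.
Lemma mem_steps_r : b \in S. Proof. by rewrite !inE eqxx !orbT. Qed.

(* In Cay(G, ±a, ±b): x is the only common neighbour of x + g and x - g. *)
Definition rigid g :=
  all (fun s => all (fun t => (s + t == g + g) ==> (s == g)) S) S.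

Lemma rigidP g s t : rigid g -> s \in S -> t \in S -> s + t = g + g -> s = g.
Proof. by move=> /allP H /H /allP K /K /implyP L /eqP /L /eqP. Qed.

Lemma rigidPn g : ~~ rigid g ->
  exists s t, [/\ s \in S, t \in S, s + t = g + g & s <> g].
Proof.
move=> /allPn[s sS /allPn[t tS]]; rewrite negb_imply => /andP[/eqP E /eqP N].
by exists s, t.
Qed.

Lemma rigid_opp g : rigid g -> rigid (- g).
Proof.
move=> H; apply/allP => s sS; apply/allP => t tS; apply/implyP => /eqP E.
rewrite -eqr_oppLR; apply/eqP; apply: (rigidP H (t := - t)); rewrite ?steps_opp //.
by abel_from (esym E).
Qed.

Lemma rigid_steps g : rigid a -> rigid b -> g \in S -> rigid g.
Proof. by move=> ra rb /stepsP[] ->; rewrite ?rigid_opp. Qed.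

(** S has at most two classes up to sign, and p and q represent different ones. *)
Lemma steps_cover p q s : p \in S -> q \in S -> p <> q -> p <> - q -> s \in S ->
  [\/ s = p, s = - p, s = q | s = - q].
Proof.
by move=> /stepsP[] -> /stepsP[] ->; rewrite ?opprK // => pq pNq /stepsP[] ->;
  rewrite ?opprK; by [constructor 1|constructor 2|constructor 3|constructor 4].
Qed.

(** Hence x and x + p + q have no common neighbours besides x + p and x + q. Any other decomposition
    of p + q can be rearranged into a forbidden decomposition of 2 p or 2 q up to sign, or into p =
    ±q. *)
Lemma rigid_sum p q s t : rigid a -> rigid b -> p \in S -> q \in S ->
  p <> q -> p <> - q -> s \in S -> t \in S -> s + t = p + q -> s = p \/ s = q.
Proof.
move=> ra rb pS qS pq pNq sS tS.
have NpS : - p \in S by rewrite steps_opp.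
have NqS : - q \in S by rewrite steps_opp.
have rp := rigid_steps ra rb pS; have rq := rigid_steps ra rb qS.
have qNp : q <> - p by move=> E; apply: pNq; rewrite E opprK.
case: (steps_cover pS qS pq pNq sS) => ->; [by left| |by right|];
  case: (steps_cover pS qS pq pNq tS) => -> E; exfalso.
- by apply: pNq; abel_from (esym E).
- by apply: pNq; apply/esym/(rigidP rp NqS NpS); abel_from (esym E).
- by apply: pq; apply/esym/(rigidP rp qS NqS); abel_from E.
- by apply: pNq; apply/esym/(rigidP rp NqS NqS); abel_from (esym E).
- by apply: pq; apply/(rigidP rq pS NpS); abel_from E.
- by apply: qNp; apply/esym/(rigidP rq NpS NpS); abel_from (esym E).
- by apply: pNq; abel_from (esym E).
- by apply: qNp; apply/esym/(rigidP rq NpS NqS); abel_from (esym E).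
Qed.

End Steps.

Lemma rigid_swap (G : zmodType) (a b g : G) : rigid b a g = rigid a b g.
Proof.
rewrite /rigid (eq_all_r (steps_swap a b)); apply: eq_all => s.
exact: eq_all_r (steps_swap a b) _.
Qed.

(* A pair (f false, f true) of bijections such that (x, e) |-> (f e x, e) is an
   automorphism of the double cover of Cay(G, ±a, ±b). *)
Record twofold (G : zmodType) (a b : G) (f : bool -> G -> G) : Prop := Twofold {
  twofold_inj : forall e, injective (f e);
  twofold_surj : forall e y, exists x, f e x = y;
  twofold_adj : forall e x y,
    (f (~~ e) y - f e x \in steps a b) = (y - x \in steps a b) }.

Lemma twofold_swap (G : zmodType) (a b : G) f : twofold a b f -> twofold b a f.
Proof.
by case=> fi fs fa; split=> // e x y; rewrite !(steps_swap a b) fa.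
Qed.

(** * Local behaviour of two-fold automorphisms *)

Section Twofold.
Variables (G : zmodType) (a b : G) (f : bool -> G -> G).
Hypothesis tf : twofold a b f.
Notation S := (steps a b).

Lemma twofold_step e x s : s \in S -> f (~~ e) (x + s) - f e x \in S.
Proof. by move=> sS; rewrite (twofold_adj tf) [x + s]addrC addrK. Qed.

Lemma twofold_common e x y z p q : p \in S -> q \in S ->
  z = f (~~ e) x + p -> z = f (~~ e) y + q ->
  exists2 w, z = f e w & w - x \in S /\ w - y \in S.
Proof.
move=> pS qS zx zy; have [w wz] := twofold_surj tf e z; exists w => //.
have := twofold_adj tf (~~ e); rewrite negbK => fa.
by split; rewrite -fa wz; [rewrite zx|rewrite zy]; rewrite [_ + _]addrC addKr.
Qed.

Lemma twofold_rigid_common e x g p q : rigid a b g -> g \in S ->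
  p \in S -> q \in S -> f (~~ e) (x + g) + p = f (~~ e) (x - g) + q ->
  f (~~ e) (x + g) + p = f e x.
Proof.
move=> rg gS pS qS E; have [w -> [w1 w2]] := twofold_common pS qS erefl E.
congr (f e _); suff wg : - (w - (x + g)) = g.
  by apply: (eq_of_subr (esym wg)); abel.
by apply: (rigidP rg _ w2); rewrite ?steps_opp //; abel.
Qed.

(** With u and w the images of the steps g and -g, the point f e x + u + w is a common neighbour of
    the images of x + g and x - g. The only such point is f e x, so u + w = 0. *)
Lemma twofold_antipodal e x g : rigid a b g -> g \in S ->
  f (~~ e) (x - g) - f e x = - (f (~~ e) (x + g) - f e x).
Proof.
move=> rg gS; have NgS : - g \in S by rewrite steps_opp.
set u := f (~~ e) (x + g) - f e x; set w := f (~~ e) (x - g) - f e x.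
have uS : u \in S := twofold_step e x gS; have wS : w \in S := twofold_step e x NgS.
have E := @twofold_rigid_common e x g w u rg gS wS uS.
by apply: (eq_of_subr (E _)); rewrite /u /w; abel.
Qed.

(** If an a-step went to ±b, the images of x + a and x - a would be f e x + b and f e x - b, which
    have a second common neighbour because b is not rigid. So x + a and x - a occupy both neighbours
    in direction a, and injectivity leaves only ±b for a b-step. *)
Lemma twofold_lines e x : rigid a b a -> ~~ rigid a b b ->
  f (~~ e) (x + a) - f e x \in [:: a; - a] /\
  f (~~ e) (x + b) - f e x \in [:: b; - b].
Proof.
move=> ra nrb; have [aS bS] := (mem_steps_l a b, mem_steps_r a b).
have ne : b <> a /\ b <> - a.
  by split=> E; move/negP: nrb; apply; rewrite [X in rigid _ _ X]E;
    first [exact: ra|exact: rigid_opp].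
have aline e' x' : f (~~ e') (x' + a) - f e' x' \in [:: a; - a].
  have := twofold_step e' x' aS; rewrite (mem_cat _ [:: a; - a] [:: b; - b]).
  case/orP=> // ub; exfalso.
  set u := f (~~ e') (x' + a) - f e' x' in ub.
  have anti := twofold_antipodal e' x' ra aS; rewrite -/u in anti.
  have [s [t [sS tS st sb]]] := rigidPn nrb.
  have NsS : - s \in S by rewrite steps_opp.
  have NtS : - t \in S by rewrite steps_opp.
  move: ub; rewrite !inE => /orP[] /eqP ub; rewrite ub in anti.
  - have F : f (~~ e') (x' + a) - s = f (~~ e') (x' - a) + t.
      have -> : f (~~ e') (x' - a) = f e' x' - b by abel_from anti.
      have -> : f (~~ e') (x' + a) = f e' x' + b by rewrite -ub /u; abel.
      by abel_from (esym st).
    have := twofold_rigid_common ra aS NsS tS F; rewrite -[X in X = _]subr0.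
    by move=> K; apply: sb; apply: (eq_of_subr (esym K)); rewrite -ub /u; abel.
  - have F : f (~~ e') (x' + a) + s = f (~~ e') (x' - a) - t.
      have -> : f (~~ e') (x' - a) = f e' x' + b by abel_from anti.
      have -> : f (~~ e') (x' + a) = f e' x' - b by rewrite -ub /u; abel.
      by abel_from st.
    have := twofold_rigid_common ra aS sS NtS F; rewrite -[X in X = _]subr0.
    move=> K; apply: sb; apply: (eq_of_subr K).
    by rewrite -[b]opprK -ub /u; abel.
split=> //; have := twofold_step e x bS.
rewrite (mem_cat _ [:: a; - a] [:: b; - b]) => /orP[ub|//]; exfalso.
have anti := twofold_antipodal e x ra aS.
have : f (~~ e) (x + b) = f (~~ e) (x + a) \/ f (~~ e) (x + b) = f (~~ e) (x - a).
  have := aline e x; move: ub; rewrite !inE => /orP[] /eqP ub /orP[] /eqP va;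
    rewrite va in anti; [left|right|right|left];
    by [apply: (eq_of_subr (etrans ub (esym va))); abel
       |rewrite ?opprK in anti; apply: (eq_of_subr (etrans ub (esym anti))); abel].
by case=> /(twofold_inj tf) /addrI; tauto.
Qed.

(** The sign is constant along a line: turning back would repeat a value of f, unless 2 g = 0, when
    both signs agree. *)
Lemma twofold_multiples g : (forall e x, f (~~ e) (x + g) - f e x \in [:: g; - g]) ->
  forall k e x, f (e (+) odd k) (x + g *+ k) - f e x \in [:: g *+ k; - (g *+ k)].
Proof.
move=> fg k e x; pose y j := f (e (+) odd j) (x + g *+ j).
have ystep j : y j.+1 - y j \in [:: g; - g].
  by rewrite /y mulrSr addrA /= addbN.
set d := y 1%N - y 0%N.
have dg : d = g \/ d = - g by have := ystep 0%N; rewrite !inE => /orP[] /eqP; tauto.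
have ynext j : y j.+1 - y j = d -> y j.+2 - y j.+1 = d.
  move=> yj; have [gg|gg] := eqVneq (g + g) 0.
    have eg : - g = g by abel_from (esym gg).
    have -> : d = g by case: dg => ->.
    by have := ystep j.+1; rewrite !inE eg orbb => /eqP.
  have yjj : y j.+2 <> y j.
    rewrite /y /= negbK => /(twofold_inj tf)/addrI/(congr1 (+%R^~ (- (g *+ j)))).
    by move=> E; move/eqP: gg; apply; abel_from E.
  have := ystep j.+1; rewrite !inE.
  case: dg yj => -> yj /orP[] /eqP E //; case: yjj; abel_from (congr2 +%R E yj).
have yd j : y j.+1 - y j = d by elim: j => // j /ynext.
have yk : y k - y 0%N = d *+ k.
  elim: k => [|j IH]; first by rewrite subrr.
  by abel_from (congr2 +%R IH (yd j)).
move: yk; rewrite /y addbF addr0 => ->; rewrite !inE.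
by case: dg => ->; rewrite ?mulNrn eqxx ?orbT.
Qed.

Section Rigid.
Hypotheses (ra : rigid a b a) (rb : rigid a b b).

Lemma twofold_independent e x u w : u \in S -> w \in S -> u <> w -> u <> - w ->
  f (~~ e) (x + u) - f e x <> f (~~ e) (x + w) - f e x /\
  f (~~ e) (x + u) - f e x <> - (f (~~ e) (x + w) - f e x).
Proof.
move=> uS wS uw uNw; split=> [/addIr/(twofold_inj tf)/addrI //|].
rewrite -(twofold_antipodal _ _ (rigid_steps ra rb wS)) //.
by move=> /addIr/(twofold_inj tf)/addrI.
Qed.

(** The images p, q of the first steps and s, t of the last ones satisfy t - s = p - q, so t is p or
    -q by [rigid_sum]. The choice t = -q would bring the image of x + u + w back to that of x. *)
Lemma twofold_square e x u w : u \in S -> w \in S -> u <> w -> u <> - w ->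
  f e (x + u + w) - f (~~ e) (x + u) = f (~~ e) (x + w) - f e x.
Proof.
move=> uS wS uw uNw; have [pq pNq] := twofold_independent e x uS wS uw uNw.
have pS := twofold_step e x uS; have qS := twofold_step e x wS.
have := twofold_step (~~ e) (x + u) wS; have := twofold_step (~~ e) (x + w) uS.
rewrite !negbK [x + w + u]addrAC.
set p := f _ (x + u) - _ in pq pNq pS *; set q := f _ (x + w) - _ in pq pNq qS *.
set t := _ - f (~~ e) (x + w); set s := _ - f (~~ e) (x + u) => tS sS.
have [||||tp|tq] := rigid_sum ra rb pS (q := - q) _ pNq _ tS (t := - s).
- by rewrite steps_opp.
- by rewrite opprK.
- by rewrite steps_opp.
- by rewrite /t /s /p /q; abel.
- by move: tp; rewrite /t /s /p /q => tp; abel_from tp.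
have E : x + u + w = x.
  by apply: (@twofold_inj _ _ _ _ tf e); move: tq; rewrite /t /q => tq; abel_from tq.
by case: uNw; abel_from E.
Qed.

Lemma twofold_straight e x u : u \in S ->
  f e (x + u + u) - f (~~ e) (x + u) = f (~~ e) (x + u) - f e x.
Proof.
move=> uS; have := twofold_antipodal (~~ e) (x + u) (rigid_steps ra rb uS) uS.
by rewrite negbK addrK => E; abel_from E.
Qed.

End Rigid.

Definition parity_generated :=
  forall e x, exists p q, x = a *+ p + b *+ q /\ odd (p + q) = e.

(** A and B are read off at 0 in layer false. Straight lines and squares carry them along walks, and
    walks of both parities are needed to reach every vertex in both layers. *)
Lemma twofold_affine : parity_generated -> a <> b -> a <> - b ->
  rigid a b a -> rigid a b b ->
  exists A B, [/\ A \in S, B \in S, A <> B /\ A <> - B &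
    forall e x, f (~~ e) (x + a) = f e x + A /\ f (~~ e) (x + b) = f e x + B].
Proof.
move=> gen ab aNb ra rb; have [aS bS] := (mem_steps_l a b, mem_steps_r a b).
have [ba bNa] : b <> a /\ b <> - a.
  by split=> E; [apply: ab|apply: aNb]; rewrite E ?opprK.
pose A := f true (0 + a) - f false 0; pose B := f true (0 + b) - f false 0.
exists A, B; split; [exact: (twofold_step false 0 aS)|exact: (twofold_step false 0 bS)| |].
  exact: (twofold_independent ra rb false 0 aS bS).
move=> e x; have [p [q [-> <-]]] := gen e x.
suff [EA EB] : f (~~ odd (p + q)) (a *+ p + b *+ q + a) - f (odd (p + q)) (a *+ p + b *+ q) = A /\
    f (~~ odd (p + q)) (a *+ p + b *+ q + b) - f (odd (p + q)) (a *+ p + b *+ q) = B.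
  by split; [abel_from EA|abel_from EB].
have stepa e' y : f (~~ e') (y + a) - f e' y = A -> f (~~ e') (y + b) - f e' y = B ->
    f e' (y + a + a) - f (~~ e') (y + a) = A /\ f e' (y + a + b) - f (~~ e') (y + a) = B.
  by move=> <- <-; rewrite twofold_straight // twofold_square.
have stepb e' y : f (~~ e') (y + a) - f e' y = A -> f (~~ e') (y + b) - f e' y = B ->
    f e' (y + b + a) - f (~~ e') (y + b) = A /\ f e' (y + b + b) - f (~~ e') (y + b) = B.
  by move=> <- <-; rewrite twofold_straight // twofold_square.
elim: q => [|q [IHa IHb]].
  rewrite addn0 addr0; elim: p => [|p [IHa IHb]]; first by rewrite mulr0n.
  by rewrite mulrSr /= negbK; apply: stepa.
by rewrite mulrSr addrA addnS /= negbK; apply: stepb.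
Qed.

End Twofold.

Lemma twofold_walk (G : zmodType) (a b A B : G) f :
  (forall e x, f (~~ e) (x + a) = f e x + A /\ f (~~ e) (x + b) = f e x + B) ->
  forall e x p q, f (e (+) odd (p + q)) (x + a *+ p + b *+ q) =
                  f e x + A *+ p + B *+ q :> G.
Proof.
move=> fAB e x p q; elim: q => [|q IH].
  rewrite addn0 !addr0; elim: p => [|p IH]; first by rewrite addbF !addr0.
  by rewrite !mulrSr !addrA /= addbN (fAB _ _).1 IH.
by rewrite addnS !mulrSr !addrA /= addbN (fAB _ _).2 IH.
Qed.

(** * Classification of the unstable grids *)

(** The presentation of G in the form used below; [grid_height] stands for the homomorphism to Z_m
    that kills a and sends b to 1. *)
Record grid (G : zmodType) (a b : G) (m n r : nat) : Prop := Grid {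
  grid_m : (1 < m)%N;
  grid_n : (1 < n)%N;
  grid_gen : forall x, exists p q : nat, x = a *+ p + b *+ q;
  grid_order : forall p : int, a *~ p = 0 <-> (n%:Z %| p)%Z;
  grid_glue : b *+ m = a *+ r;
  grid_height : forall p q : int, b *~ q = a *~ p -> (m%:Z %| q)%Z }.

Section Grid.
Variables (G : zmodType) (a b : G) (m n r : nat).
Hypothesis gr : grid a b m n r.

Lemma grid_rel (p q : int) :
  a *~ p + b *~ q = 0 <-> exists t, q = t * m%:Z /\ (n%:Z %| p + t * r%:Z)%Z.
Proof.
have glue t : b *~ (t * m%:Z) = a *~ (t * r%:Z).
  by rewrite !(mulrC t) !mulrzA -!pmulrn (grid_glue gr).
split=> [E|[t [-> /(grid_order gr)]]]; last by rewrite glue -mulrzDr.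
have /dvdzP[t qE] : (m%:Z %| q)%Z.
  by apply: (@grid_height _ _ _ _ _ _ gr (- p)); abel_from E.
exists t; split=> //; apply/(grid_order gr).
by rewrite mulrzDr -glue -qE.
Qed.

Lemma grid_order_nat p : a *+ p = 0 <-> (n %| p)%N.
Proof. by rewrite pmulrn; split=> [/(grid_order gr)|H]; [|apply/(grid_order gr)]. Qed.

Lemma grid_b_notin (p : int) : b <> a *~ p.
Proof.
move=> E; have := @grid_height _ _ _ _ _ _ gr p 1 E.
by move=> /dvdn_leq; have := grid_m gr; rewrite ltnNge => /negbTE ->; move/(_ isT).
Qed.

(** n and r + m are the lengths of the closed walks given by n a = 0 and m b = r a; the graph is
    bipartite exactly when both are even. *)
Definition nonbip_grid := odd n || odd (r + m).

Lemma grid_odd_rel : nonbip_grid ->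
  exists p q, a *+ p = b *+ q /\ odd (p + q).
Proof.
case/orP=> [on|orm]; last by exists r, m; rewrite (grid_glue gr).
by exists n, 0%N; rewrite addn0 mulr0n; split=> //; apply/grid_order_nat.
Qed.

Lemma grid_parity_generated : nonbip_grid -> parity_generated a b.
Proof.
move=> /grid_odd_rel[p0 [q0 [E o]]] e x; have [p [q ->]] := grid_gen gr x.
have [oe|/eqP oNe] := eqVneq (odd (p + q)) e; first by exists p, q.
(* The zero element p0 a - q0 b is added to flip the parity. Coefficients being natural, -q0 b is
   written (2 n - 1) q0 b, where 2 n - 1 is odd and 2 n q0 b = 2 n p0 a = 0. *)
exists (p + p0)%N, (q + q0 * (2 * n - 1))%N; split; last first.
  have n1 := grid_n gr; move: o oNe; rewrite !oddD oddM oddB ?oddM /=; last by lia.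
  by rewrite andbT; case: (odd p0); case: (odd q0); case: (odd p); case: (odd q); case: e.
have n0 : b *+ (q0 * (2 * n)) = 0.
  rewrite mulrnA -E -mulrnA; apply/grid_order_nat.
  by rewrite mulnA dvdn_mull.
have -> : b *+ (q + q0 * (2 * n - 1)) = b *+ q + b *+ (q0 * (2 * n)) - b *+ q0.
  by rewrite mulnBr muln1 mulrnDr mulrnBr ?leq_pmulr ?addrA //; have := grid_n gr; lia.
by rewrite n0 -E mulrnDr; abel.
Qed.

Section Exceptional.
Hypotheses (tw : b + b <> a + a) (twN : b + b <> - (a + a)).

Let b_ne_a : b <> a. Proof. exact: (@grid_b_notin 1). Qed.
Let b_ne_Na : b <> - a. Proof. exact: (@grid_b_notin (-1)). Qed.

Lemma nonrigid_l : ~~ rigid a b a -> a *+ 4 = 0.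
Proof.
move=> /rigidPn[s [t [/stepsP[] -> /stepsP[] -> E sa]]] //.
- by abel_from (congr2 +%R E E).
- by abel_from E.
- by case: (@grid_b_notin 3); abel_from E.
- by case: (@grid_b_notin (-3)); abel_from E.
- by case: b_ne_a; abel_from E.
- by case: (@grid_b_notin 3); abel_from E.
- by abel_from (congr2 +%R E E).
- by case: b_ne_Na; abel_from E.
- by case: (@grid_b_notin (-3)); abel_from E.
- by abel_from (congr2 +%R E E).
- by case: twN; abel_from E.
Qed.

Lemma nonrigid_r : ~~ rigid a b b ->
  [\/ b *+ 4 = 0, b *+ 3 = a | b *+ 3 = - a].
Proof.
move=> /rigidPn[s [t [/stepsP[] -> /stepsP[] -> E sb]]] //.
- by case: tw.
- by constructor 1; abel_from (congr2 +%R E E).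
- by case: b_ne_a; abel_from E.
- by constructor 2; abel_from E.
- by constructor 1; abel_from (congr2 +%R E E).
- by case: twN; abel_from E.
- by case: b_ne_Na; abel_from E.
- by constructor 3; abel_from E.
- by constructor 2; abel_from E.
- by constructor 3; abel_from E.
- by constructor 1; abel_from (congr2 +%R E E).
- by constructor 1; abel_from E.
Qed.

End Exceptional.
End Grid.

(** From x - p a, both p steps a and q steps b lead to x, but in different layers as p + q is odd.
    Both images differ from the same point by ±p a, and p a = -p a. *)
Lemma twofold_lines_collapse (G : zmodType) (a b : G) f p q :
  twofold a b f ->
  (forall e x, f (~~ e) (x + a) - f e x \in [:: a; - a]) ->
  (forall e x, f (~~ e) (x + b) - f e x \in [:: b; - b]) ->
  a *+ p = b *+ q -> odd (p + q) -> a *+ (p + p) = 0 ->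
  forall x, f true x = f false x.
Proof.
move=> tf fa fb E o pp x.
have := twofold_multiples tf fa p (odd p) (x - a *+ p).
have := twofold_multiples tf fb q (odd p) (x - a *+ p).
rewrite addbb -{1}E -oddD o !subrK -E.
have -> : - (a *+ p) = a *+ p by abel_from pp.
rewrite !inE !orbb => /eqP E1 /eqP E2; abel_from (congr2 (fun u v => u - v) E1 E2).
Qed.

(** * Two-fold automorphisms of nonbipartite grids with 2 b different from ±2 a *)

Section Classification.
Variables (G : zmodType) (a b : G) (m n r : nat) (f : bool -> G -> G).
Hypotheses (gr : grid a b m n r) (nb : nonbip_grid m n r).
Hypotheses (tw : b + b <> a + a) (twN : b + b <> - (a + a)).
Hypothesis tf : twofold a b f.

Let rel_even_r p q : a *+ p = b *+ q -> b *+ 4 = 0 -> ~~ odd q.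
Proof.
move=> E b4; apply/negP => oq.
have Pq : (m %| q)%N.
  by apply: (@grid_height _ _ _ _ _ _ gr p q); rewrite -!pmulrn E.
have P4 : (m %| 4)%N by apply: (@grid_height _ _ _ _ _ _ gr 0 4 b4).
have : (m %| gcdn q 4)%N by rewrite dvdn_gcd Pq P4.
suff -> : gcdn q 4 = 1%N by rewrite dvdn1 => /eqP m1; have := grid_m gr; rewrite m1.
by apply/eqP; rewrite -/(coprime q 4) (coprimeXr 2 (n := 2)) // coprimen2.
Qed.

Let order4 : a *+ 4 = 0 -> n = 2%N \/ n = 4%N.
Proof.
move=> /(grid_order_nat gr) n4; have := grid_n gr.
by have := dvdn_leq (isT : (0 < 4)%N) n4; case: n n4 => [|[|[|[|[|k]]]]] //; auto.
Qed.

(** Here n divides 4. If n = 2, every p satisfies 2 p a = 0; if n = 4 and r is even, the glue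
    relation has 2 r a = 0; both collapse. The case n = 4 with r odd is a genuine member of family
    (1). *)
Lemma twofold_rigid_r : ~~ rigid a b a -> rigid a b b ->
  (forall x, f true x = f false x) \/ n = 4 /\ odd r /\ odd (m + 1).
Proof.
move=> nra rb; have a4 := nonrigid_l gr tw twN nra.
have ln e x := @twofold_lines _ b a f (twofold_swap tf) e x.
have fb e x : f (~~ e) (x + b) - f e x \in [:: b; - b].
  by apply: (ln e x _ _).1; rewrite rigid_swap.
have fa e x : f (~~ e) (x + a) - f e x \in [:: a; - a].
  by apply: (ln e x _ _).2; rewrite rigid_swap.
have [p [q [E o]]] := grid_odd_rel gr nb.
have [n2|n4] := order4 a4.
  left; apply: (twofold_lines_collapse tf fa fb E o).
  by apply/(grid_order_nat gr); rewrite n2 addnn dvdn2 odd_double.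
have orm : odd (r + m) by move: nb; rewrite /nonbip_grid n4.
have [or|er] := boolP (odd r).
  by right; split=> //; split=> //; move: orm; rewrite oddD or /= addn1 /=.
left; apply: (twofold_lines_collapse tf fa fb (esym (grid_glue gr)) orm).
apply/(grid_order_nat gr); rewrite n4 addnn -(odd_double_half r) (negbTE er) add0n.
by rewrite -!muln2 -mulnA dvdn_mull.
Qed.

(** If an odd multiple of b vanishes, a b-line closes up after an odd number of steps, which
    identifies the two layers; for 3 b = ±a, any odd relation provides such a multiple. If 4 b = 0,
    then q is even in every relation p a = q b, so 2 p a = 2 q b = 0. *)
Lemma twofold_rigid_l : rigid a b a -> ~~ rigid a b b ->
  forall x, f true x = f false x.
Proof.
move=> ra nrb x; have [p [q [E o]]] := grid_odd_rel gr nb.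
have ln e y := twofold_lines tf e y ra nrb.
have fa e y := (ln e y).1; have fb e y := (ln e y).2.
have odd_order k : b *+ k = 0 -> odd k -> f true x = f false x.
  move=> k0 ok; have := twofold_multiples tf fb k false x.
  by rewrite k0 ok addr0 oppr0 !inE orbb subr_eq0 => /eqP.
case: (nonrigid_r gr tw twN nrb) => [b4|ba|bNa].
- apply: (twofold_lines_collapse tf fa fb E o).
  rewrite mulrnDr E -mulrnDr addnn -[q]odd_double_half (negbTE (rel_even_r E b4)).
  by rewrite add0n -!muln2 -mulnA mulnC mulrnA b4 mul0rn.
- have [pq|pq] := leqP q (3 * p).
    apply: (odd_order (3 * p - q)%N); last by move: o pq; clear; lia.
    by rewrite mulrnBr // mulrnA ba E subrr.
  apply: (odd_order (q - 3 * p)%N); last by move: o pq; clear; lia.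
  by rewrite mulrnBr ?(ltnW pq) // mulrnA ba E subrr.
- apply: (odd_order (3 * p + q)%N); last by move: o; clear; lia.
  by rewrite mulrnDr mulrnA bNa mulNrn E addNr.
Qed.

(** n is 2 or 4, so r + m is odd and only even multiples of a vanish. If 3 b = ±a, then m = 3 and r
    is even, and an odd multiple of a would vanish. If 4 b = 0, then m = 2, 2 a = 0 and 2 b = a, so
    G is cyclic of order 4 and the graph is K_4. *)
Lemma twofold_nonrigid : ~~ rigid a b a -> ~~ rigid a b b ->
  forall x, f true x = f false x.
Proof.
move=> nra nrb x; have a4 := nonrigid_l gr tw twN nra.
have en : ~~ odd n by case: (order4 a4) => ->.
have orm : odd (r + m) by move: nb; rewrite /nonbip_grid (negbTE en).
have na p : a *+ p = 0 -> ~~ odd p.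
  by move=> /(grid_order_nat gr) /dvdn_odd H; apply: contra en => /H.
have heightP k p : b *+ k = a *+ p -> (m %| k)%N.
  by move=> E; apply: (@grid_height _ _ _ _ _ _ gr p k); rewrite -!pmulrn E.
have m3 : (m %| 3)%N -> b *+ 3 = a *+ r /\ ~~ odd r.
  move=> m3; suff m3E : m = 3%N.
    by rewrite -(grid_glue gr) m3E; move: orm; rewrite m3E addn3 /= negbK.
  have := dvdn_leq (isT : (0 < 3)%N) m3; have := grid_m gr; have := m3.
  by case: (m) => [|[|[|[|k]]]].
case: (nonrigid_r gr tw twN nrb) => [b4|ba|bNa].
- have em := rel_even_r (esym (grid_glue gr)) b4.
  have or : odd r by move: orm; rewrite oddD (negbTE em) addbF.
  have m2 : m = 2%N.
    have m4 : (m %| 4)%N by apply: (heightP 4%N 0%N).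
    have := dvdn_leq (isT : (0 < 4)%N) m4; have := grid_m gr; have := grid_glue gr; move: m4 em.
    case: (m) => [|[|[|[|[|k]]]]] // _ _ E _ _.
    by move: (na r); rewrite or -E => /(_ b4).
  have aa : a + a = 0.
    have : a *+ (r + r) = 0 by rewrite mulrnDr -(grid_glue gr) m2 -mulrnDr.
    move=> /(grid_order_nat gr); case: (order4 a4) => n2; rewrite n2.
      by move=> _; apply: (grid_order_nat gr 2).2; rewrite n2.
    by rewrite addnn -muln2 (@dvdn_pmul2r 2 2) // dvdn2 or.
  have bb : b + b = a.
    have := grid_glue gr; rewrite m2 mulr2n => ->.
    rewrite -[r]odd_double_half or mulrnDr -muln2 mulnC mulrnA (mulr2n a) aa.
    by rewrite mul0rn addr0.
  have S0 : 0 \notin steps a b.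
    have b0 : b <> 0 by have := @grid_b_notin _ _ _ _ _ _ gr 0.
    have a0 : a <> 0.
      by move/(grid_order_nat gr 1); rewrite dvdn1; have := grid_n gr; case: eqP => // ->.
    by rewrite !inE ![0 == _]eq_sym !oppr_eq0; apply/negP => /or4P[] /eqP.
  have [p [q d]] := grid_gen gr (f true x - f false x).
  have dE : f true x - f false x = b *+ ((2 * p + q) %% 4).
    rewrite d -bb mulrnDl -mulrnDr addnn -mul2n -mulrnDr {1}(divn_eq (2 * p + q) 4).
    by rewrite mulrnDr mulnC mulrnA b4 mul0rn add0r.
  (* The difference f true x - f false x is not a step, because 0 is not; but every nonzero multiple
     of b is a step. *)
  have := twofold_adj tf false x x; rewrite subrr (negbTE S0) /= dE => /negbT.
  have k4 : ((2 * p + q) %% 4 < 4)%N by rewrite ltn_pmod.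
  case: (_ %% 4)%N k4 dE => [|k] k4 dE nS.
    by move/eqP: dE; rewrite mulr0n subr_eq0 => /eqP.
  case/negP: nS; move: k4 {dE}; case: k => [|[|[|k]]] // _.
  + exact: mem_steps_r.
  + by rewrite mulr2n bb mem_steps_l.
  + suff -> : b *+ 3 = - b by rewrite steps_opp mem_steps_r.
    by abel_from b4.
- have [E er] := m3 (heightP _ 1%N ba).
  have : a *+ (r + 3) = 0 by rewrite mulrnDr -E ba -mulrS.
  by move/na; rewrite addn3 /= er.
- have [E er] : b *+ 3 = a *+ r /\ ~~ odd r.
    by apply/m3/(heightP _ 3%N); rewrite bNa; abel_from a4.
  have : a *+ (r + 1) = 0 by rewrite mulrnDr -E bNa addNr.
  by move/na; rewrite addn1 /= er.
Qed.

Section Affine.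
Variables A B : G.
Hypothesis fAB : forall e x, f (~~ e) (x + a) = f e x + A /\ f (~~ e) (x + b) = f e x + B.

Lemma twofold_even_rel p q p' q' : a *+ p + b *+ q = a *+ p' + b *+ q' ->
  odd (p + q) = odd (p' + q') -> A *+ p + B *+ q = A *+ p' + B *+ q'.
Proof.
move=> E o; have := twofold_walk fAB false 0 p q.
rewrite -addrA E o addrA (twofold_walk fAB) -!addrA => /addrI F.
by rewrite F.
Qed.

(** The relation gives one equation per layer, with f true 0 and f false 0 interchanged; adding the
    two cancels them and doubles the rest. *)
Lemma twofold_odd_rel p q p' q' : a *+ p + b *+ q = a *+ p' + b *+ q' ->
  odd (p + q) != odd (p' + q') ->
  A *+ (2 * p) + B *+ (2 * q) = A *+ (2 * p') + B *+ (2 * q') /\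
  (A *+ p + B *+ q = A *+ p' + B *+ q' -> forall x, f true x = f false x).
Proof.
move=> E o; have W e := twofold_walk fAB e 0.
have H e : f e 0 + A *+ p + B *+ q = f (~~ e) 0 + A *+ p' + B *+ q'.
  rewrite -!W -!addrA E !addrA; congr (f _ _).
  by move: o; case: e; case: odd; case: odd.
split.
  have H1 := H true; have H0 := H false.
  by rewrite ![(2 * _)%N]mul2n -!addnn; abel_from (congr2 +%R H1 H0).
move=> F x; have f0 : f true 0 = f false 0.
  by have := H true; rewrite -!addrA F => /addIr.
have [p1 [q1 [-> oe]]] := grid_parity_generated gr nb true x.
have := W false p1 q1; have := W true p1 q1.
by rewrite oe !add0r addbT /= => -> ->; rewrite f0.
Qed.

End Affine.

(* wilson1 and wilson2 are the families (1) and (2); wilson2' is the other form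
   Qd(m,2km,2lm) of (2), the one that arises when n is even. *)
Definition wilson1 := exists k : nat, n = (4 * k)%N /\ odd (m + k) /\
  ((n%:Z %| r%:Z - k%:Z)%Z \/ (n%:Z %| r%:Z + k%:Z)%Z).

Definition wilson2 := exists (h k : nat) (l : int),
  [/\ m = (2 * h)%N, n = (k * h)%N, odd h,
      (k%:Z %| 4 * l ^+ 2 - 1)%Z \/ (k%:Z %| 4 * l ^+ 2 + 1)%Z &
      (n%:Z %| r%:Z - 4 * l * h%:Z)%Z].

Definition wilson2' := exists (k : nat) (l : int),
  [/\ odd m, n = (2 * k * m)%N,
      (k%:Z %| 4 * l ^+ 2 - 1)%Z \/ (k%:Z %| 4 * l ^+ 2 + 1)%Z &
      (n%:Z %| r%:Z - 2 * l * m%:Z)%Z].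

(** In 4 r = j n the factor j is odd, so n = 4 k and r = j k; the sign of k is j modulo 4. *)
Lemma reflection_arith : odd (r + m) -> (n %| 4 * r)%N -> ~~ (n %| 2 * r)%N -> wilson1.
Proof.
move=> orm /dvdnP[j jE] n2.
have oj : odd j.
  apply: contraR n2 => ej; apply/dvdnP; exists j./2.
  by move: ej jE; lia.
have : (4 %| n)%N.
  rewrite -(@Gauss_dvdr 4 j) ?(coprimeXl 2 (m := 2)) ?coprime2n //.
  by rewrite -jE dvdn_mulr.
case/dvdnP=> k kE; exists k; rewrite mulnC; split=> //.
have rE : r = (j * k)%N by move: jE; rewrite kE; lia.
split; first by move: orm; rewrite rE !oddD oddM oj /= addbC.
have [i jiE] : exists i, j = (4 * i + 1)%N \/ j = (4 * i + 3)%N.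
  by exists (j %/ 4)%N; move: oj; lia.
by case: jiE => ji; [left|right]; apply/dvdzP;
  [exists i%:Z | exists (i%:Z + 1)]; rewrite rE kE ji; lia.
Qed.

Let glue_mul t : b *~ (t * m%:Z) = a *~ (t * r%:Z).
Proof. by rewrite !(mulrC t) !mulrzA -!pmulrn (grid_glue gr). Qed.

Let unit_sq (k s : nat) (u v : int) : u = 1 \/ u = -1 -> v = 1 \/ v = -1 ->
  (k%:Z %| u * s%:Z ^+ 2 - v)%Z ->
  (k%:Z %| s%:Z ^+ 2 - 1)%Z \/ (k%:Z %| s%:Z ^+ 2 + 1)%Z.
Proof.
case=> ->; case=> ->; rewrite ?mul1r ?opprK ?mulN1r; [by left|by right| |].
  by rewrite -opprD rpredN; right.
by rewrite addrC -opprB rpredN; left.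
Qed.

(** n b = 0 gives n = c m, and then c r a = 0 gives r = s m. Parity makes m odd and s, c even, so k
    = c / 2 and l = s / 2; the doubled glue relation becomes 2 m (u s^2 - v) a = 0. *)
Lemma rotation_arith_even (u v : int) : u = 1 \/ u = -1 -> v = 1 \/ v = -1 ->
  odd (r + m) -> ~~ odd n -> b *+ n = 0 ->
  b *~ (u * (2 * r)%:Z) = a *~ (v * (2 * m)%:Z) -> wilson2'.
Proof.
move=> u1 v1 orm en bn E; have m0 : (0 < m)%N by have := grid_m gr; lia.
have /dvdnP[c nE] : (m %| n)%N.
  by apply: (@grid_height _ _ _ _ _ _ gr 0 n); rewrite -!pmulrn.
have c0 : (0 < c)%N by have := grid_n gr; rewrite nE; case: (c).
have /dvdnP[s rE] : (m %| r)%N.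
  rewrite -(@dvdn_pmul2l c) // -nE; apply/(grid_order_nat gr).
  by rewrite mulnC mulrnA -(grid_glue gr) -mulrnA mulnC -nE.
have om : odd m by move: orm; rewrite rE oddD oddM; case: (odd m); rewrite ?andbF.
have es : ~~ odd s by move: orm; rewrite rE oddD oddM om andbT addbT.
have ec : ~~ odd c by move: en; rewrite nE oddM om andbT.
exists c./2, s./2%:Z.
have nE2 : n = (2 * c./2 * m)%N by rewrite nE; congr (_ * _)%N; move: ec; lia.
have sE : s = (2 * s./2)%N by move: es; lia.
split=> //; last by rewrite rE {1}sE PoszM PoszM subrr.
have -> : 4 * s./2%:Z ^+ 2 = s%:Z ^+ 2 by rewrite [in RHS]sE PoszM; ring.
apply: (unit_sq u1 v1).
have : (n%:Z %| (2 * m)%:Z * (u * s%:Z ^+ 2 - v))%Z.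
  apply/(grid_order gr); rewrite mulrBr mulrzBr; apply/eqP; rewrite subr_eq0; apply/eqP.
  have -> : (2 * m)%:Z * v = v * (2 * m)%:Z by ring.
  rewrite -E; have -> : u * (2 * r)%:Z = u * 2 * s%:Z * m%:Z by rewrite rE !PoszM; ring.
  by rewrite glue_mul rE !PoszM; congr (_ *~ _); ring.
have -> : n%:Z = (2 * m)%:Z * c./2%:Z by rewrite {1}nE2 !PoszM; ring.
by rewrite dvdz_mul2l //; move: m0; clear; lia.
Qed.

Lemma rotation_arith_odd (u v : int) : u = 1 \/ u = -1 -> v = 1 \/ v = -1 ->
  odd n -> b *+ (2 * n) = 0 -> b *+ n <> 0 ->
  (forall R, a *+ R = b *+ m -> ~~ odd (R + m) ->
    b *~ (u * R%:Z) = a *~ (v * m%:Z)) -> wilson2.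
Proof.
move=> u1 v1 on b2n bn E; have m0 : (0 < m)%N by have := grid_m gr; lia.
have m2n : (m %| 2 * n)%N.
  by apply: (@grid_height _ _ _ _ _ _ gr 0 (2 * n)%N); rewrite -!pmulrn.
have em : ~~ odd m.
  apply/negP => om; apply: bn.
  have /dvdnP[c nE] : (m %| n)%N.
    by rewrite -(@Gauss_dvdr m 2) ?coprimen2.
  have bc : b *+ n = a *+ (r * c) by rewrite nE mulnC mulrnA (grid_glue gr) mulrnA.
  rewrite bc; apply/(grid_order_nat gr).
  rewrite -(@Gauss_dvdr n 2) ?coprimen2 //; apply/(grid_order_nat gr).
  by rewrite mulnC mulrnA -bc -mulrnA mulnC.
have /dvdnP[h mE] : (2 %| m)%N by rewrite dvdn2.
have /dvdnP[k nE] : (h %| n)%N by rewrite -(@dvdn_pmul2l 2) // mulnC -mE.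
have [ok oh] : odd k /\ odd h by move: on; rewrite nE oddM => /andP[].
(* An even representative R of r modulo the odd n makes R + m even, so that R a = m b itself is
   preserved and not only its double. *)
have [R [aR eR nR]] : exists R, [/\ a *+ R = b *+ m, ~~ odd R & (n%:Z %| r%:Z - R%:Z)%Z].
  have [or|er] := boolP (odd r); last first.
    by exists r; rewrite (grid_glue gr) subrr dvdz0.
  exists (r + n)%N; rewrite oddD or on mulrnDr (grid_glue gr).
  rewrite ((grid_order_nat gr n).2 (dvdnn n)) addr0; split=> //.
  by rewrite PoszD opprD addrA subrr sub0r rpredN dvdzz.
have ER := E R aR; rewrite oddD (negbTE eR) (negbTE em) in ER; have {}ER := ER isT.
have /dvdnP[s RE] : (m %| R)%N.
  have := @grid_height _ _ _ _ _ _ gr _ _ ER.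
  by case: u1 => ->; rewrite ?mul1r ?mulN1r ?rpredN.
have bm t : b *~ (t * m%:Z) = a *~ (t * R%:Z).
  by rewrite !(mulrC t) !mulrzA -!pmulrn aR.
(* As k is odd, (k + 1) / 2 inverts 2 modulo k: this gives 2 l = s modulo k and 4 l h = R modulo
   n. *)
exists h, k, ((s * (k + 1)./2)%N : int); split=> //; first by rewrite mulnC.
  have : (n%:Z %| m%:Z * (u * s%:Z ^+ 2 - v))%Z.
    apply/(grid_order gr); rewrite mulrBr mulrzBr; apply/eqP; rewrite subr_eq0; apply/eqP.
    have -> : m%:Z * v = v * m%:Z by ring.
    rewrite -ER; have -> : u * R%:Z = u * s%:Z * m%:Z by rewrite RE !PoszM; ring.
    by rewrite bm RE !PoszM; congr (_ *~ _); ring.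
  have -> : n%:Z = h%:Z * k%:Z by rewrite nE PoszM mulrC.
  have -> : m%:Z = h%:Z * 2 by rewrite mE PoszM.
  have h0 : h%:Z != 0 by rewrite eqz_nat -lt0n; move: oh; case: (h).
  rewrite -mulrA dvdz_mul2l // Gauss_dvdzr; last first.
    by rewrite coprimezE; exact: etrans (coprimen2 k) ok.
  move/(unit_sq u1 v1).
  have -> : 4 * ((s * (k + 1)./2)%N : int) ^+ 2 = s%:Z ^+ 2 + k%:Z * (s%:Z ^+ 2 * (k%:Z + 2)).
    have -> : 4 * ((s * (k + 1)./2)%N : int) ^+ 2 = (s%:Z * (2 * (k + 1)./2)%:Z) ^+ 2.
      by rewrite !PoszM; ring.
    have -> : (2 * (k + 1)./2)%N = (k + 1)%N by move: ok; lia.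
    by rewrite PoszD; ring.
  have K x y : (k%:Z %| x + k%:Z * y)%Z = (k%:Z %| x)%Z.
    by rewrite rpredDr // dvdz_mulr.
  by rewrite ![_ + k%:Z * _ + _]addrAC !K.
have -> : r%:Z - 4 * ((s * (k + 1)./2)%N : int) * h%:Z = r%:Z - R%:Z - 2 * s%:Z * n%:Z.
  have -> : 4 * ((s * (k + 1)./2)%N : int) = 2 * s%:Z * (2 * (k + 1)./2)%:Z.
    by rewrite !PoszM; ring.
  have -> : (2 * (k + 1)./2)%N = (k + 1)%N by move: ok; lia.
  by rewrite RE mE nE !PoszM PoszD; ring.
by rewrite rpredDr // rpredN dvdz_mull.
Qed.

Lemma twofold_rigid : rigid a b a -> rigid a b b ->
  (forall x, f true x = f false x) \/ [\/ wilson1, wilson2 | wilson2'].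
Proof.
move=> ra rb.
have aNb : a <> b by move=> E; apply: (@grid_b_notin _ _ _ _ _ _ gr 1).
have aNNb : a <> - b.
  by move=> E; apply: (@grid_b_notin _ _ _ _ _ _ gr (-1)); rewrite E mulrN1z opprK.
have [A [B [AS BS [AB ANB] fAB]]] :=
  twofold_affine tf (grid_parity_generated gr nb) aNb aNNb ra rb.
have na : a *+ n = 0 by apply/(grid_order_nat gr)/dvdnn.
have N2 (x : G) k : x *+ (2 * k) = x *+ k + x *+ k by rewrite mul2n -addnn mulrnDr.
have oddn : odd n -> A *+ (2 * n) = 0 /\
    (A *+ n = 0 -> forall x, f true x = f false x).
  move=> on; have := @twofold_odd_rel A B fAB n 0 0 0.
  by rewrite !muln0 !mulr0n !addr0 na addn0 on; apply.
have evenn : ~~ odd n -> A *+ n = 0.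
  move=> en; have := @twofold_even_rel A B fAB n 0 0 0.
  by rewrite !mulr0n !addr0 na addn0 (negbTE en); apply.
have oddR R : a *+ R = b *+ m -> odd (R + m) -> A *+ (2 * R) = B *+ (2 * m) /\
    (A *+ R = B *+ m -> forall x, f true x = f false x).
  move=> ER oR; have := @twofold_odd_rel A B fAB R 0 0 m.
  rewrite !muln0 !mulr0n !addr0 !add0r addn0; apply=> //.
  by move: oR; rewrite oddD; case: (odd R); case: (odd m).
have evenR R : a *+ R = b *+ m -> ~~ odd (R + m) -> A *+ R = B *+ m.
  move=> ER eR; have := @twofold_even_rel A B fAB R 0 0 m.
  rewrite !mulr0n !addr0 !add0r addn0; apply=> //.
  by move: eR; rewrite oddD; case: (odd R); case: (odd m).
have glue := esym (grid_glue gr).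
have reflection : A = a \/ A = - a -> B = b \/ B = - b ->
    (forall x, f true x = f false x) \/ wilson1.
  move=> HA HB.
  have [on|en] := boolP (odd n).
    by left; apply: (oddn on).2; case: HA => ->; rewrite ?mulNrn na ?oppr0.
  have orm : odd (r + m) by move: nb; rewrite /nonbip_grid (negbTE en).
  have [E1 E2] := oddR r glue orm.
  have [r2|r2] := boolP (n %| 2 * r)%N.
    left; apply: E2; move/(grid_order_nat gr): r2; rewrite N2 => r2.
    have rN : - (a *+ r) = a *+ r by abel_from r2.
    by case: HA => ->; case: HB => ->; rewrite ?mulNrn (grid_glue gr) ?rN.
  have [r4|r4] := boolP (n %| 4 * r)%N; first by right; apply: reflection_arith.
  (* Equal signs preserve the glue relation outright; opposite signs turn [E1] into 4 r a = 0. *)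
  left; apply: E2; move: E1; rewrite !N2; case: HA => ->; case: HB => ->;
    rewrite ?mulNrn (grid_glue gr) // => E1; case/negP: r4;
    by apply/(grid_order_nat gr); rewrite -[4%N]/(2 * 2)%N -mulnA !N2; abel_from E1.
have rotation u v : u = 1 \/ u = -1 -> v = 1 \/ v = -1 -> A = b *~ u -> B = a *~ v ->
    (forall x, f true x = f false x) \/ wilson2 \/ wilson2'.
  move=> u1 v1 Au Bv.
  have Ak k : A *+ k = b *~ (u * k%:Z) by rewrite Au mulrzA pmulrn.
  have Bk k : B *+ k = a *~ (v * k%:Z) by rewrite Bv mulrzA pmulrn.
  have A0 k : A *+ k = 0 <-> b *+ k = 0.
    rewrite Ak pmulrn mulrC mulrzA; case: u1 => ->; rewrite ?mulr1z // mulrN1z.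
    by split=> [/eqP|->]; rewrite ?oppr_eq0 ?oppr0 // => /eqP.
  have [on|en] := boolP (odd n).
    have [E1 E2] := oddn on.
    have [bn|/eqP bn] := eqVneq (b *+ n) 0; first by left; apply/E2/A0.
    right; left; apply: (rotation_arith_odd u1 v1 on _ bn); first exact/A0.
    by move=> R ER eR; rewrite -Ak -Bk evenR.
  have orm : odd (r + m) by move: nb; rewrite /nonbip_grid (negbTE en).
  have [E1 E2] := oddR r glue orm.
  right; right; apply: (rotation_arith_even u1 v1 orm en); first exact/A0/evenn.
  by rewrite -Ak -Bk.
have signs : A = b \/ A = - b -> B = a \/ B = - a ->
    (forall x, f true x = f false x) \/ wilson2 \/ wilson2'.
  by case=> EA; case=> EB; [apply: (rotation 1 1)|apply: (rotation 1 (-1))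
    |apply: (rotation (-1) 1)|apply: (rotation (-1) (-1))];
    rewrite ?mulr1z ?mulrN1z //; tauto.
have [AB'|AB'] : (A = a \/ A = - a) /\ (B = b \/ B = - b) \/
                 (A = b \/ A = - b) /\ (B = a \/ B = - a).
  case/stepsP: AS AB ANB => ->; case/stepsP: BS => ->; rewrite ?opprK => AB ANB;
    by [case: AB | case: ANB | tauto].
- by have [?|?] := reflection AB'.1 AB'.2; [left|right; constructor 1].
- by have [?|[?|?]] := signs AB'.1 AB'.2;
    [left|right; constructor 2|right; constructor 3].
Qed.

Lemma twofold_classification : ~ (forall x, f true x = f false x) ->
  [\/ wilson1, wilson2 | wilson2'].
Proof.
move=> nf; have [ra|nra] := boolP (rigid a b a); have [rb|nrb] := boolP (rigid a b b).
- by case: (twofold_rigid ra rb).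
- by case: nf; apply: twofold_rigid_l.
- case: (twofold_rigid_r nra rb) => // -[n4 [or om]]; constructor 1; exists 1%N.
  split=> //; split=> //; rewrite n4.
  have [i] : exists i, r = (4 * i + 1)%N \/ r = (4 * i + 3)%N.
    by exists (r %/ 4)%N; move: or; clear; lia.
  by case=> ->; [left|right]; apply/dvdzP; [exists i%:Z | exists (i%:Z + 1)]; lia.
- by case: nf; apply: twofold_nonrigid.
Qed.

End Classification.

(** * The group structure of Qd(m,n,r) *)

(* The vertices of Qd(m,n,r) as the group Z^2 / <(n,0), (-r,m)>: addition of
   the second coordinates carries r into the first one. *)
Definition QdG (m n : nat) (r : 'Z_n) : Type := ('Z_n * 'Z_m)%type.

Section QdGroup.
Variables (m n : nat) (r : 'Z_n).
Notation M := (Zp_trunc m).+2.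
Notation V := (QdG m r).

HB.instance Definition _ := Finite.copy V ('Z_n * 'Z_m)%type.

Definition Qd_add (u v : V) : V := (u.1 + v.1 + r *+ ((u.2 + v.2)%N %/ M), u.2 + v.2).
(** A nonzero second coordinate and its opposite add up to M, hence carry once; the term in r
    cancels that carry. *)
Definition Qd_opp (u : V) : V := (- u.1 - r *+ (u.2 != 0), - u.2).

Lemma Qd_addC : commutative Qd_add.
Proof. by move=> u v; rewrite /Qd_add (addrC u.1) (addrC u.2) (addnC u.2). Qed.

Lemma carryA (i j k d : nat) : (0 < d)%N ->
  ((i + j) %/ d + ((i + j) %% d + k) %/ d = (i + j + k) %/ d)%N.
Proof. by move=> d0; rewrite {3}(divn_eq (i + j) d) -addnA divnMDl. Qed.

Lemma Qd_addA : associative Qd_add.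
Proof.
move=> u v w; rewrite /Qd_add /=; congr (_, _); last exact: addrA.
set A1 := (_ %/ _)%N; set A2 := (_ %/ _)%N; set A3 := (_ %/ _)%N; set A4 := (_ %/ _)%N.
have E : (A1 + A2 = A3 + A4)%N.
  rewrite /A1 /A2 /A3 /A4 carryA // [X in (_ + X %/ _)%N]addnC carryA //.
  by rewrite addnC addnA.
have : r *+ (A1 + A2) = r *+ (A3 + A4) by rewrite E.
by rewrite !mulrnDr => F; abel_from F.
Qed.

Lemma Qd_add0 : left_id ((0, 0) : V) Qd_add.
Proof.
case=> x i; rewrite /Qd_add /= !add0r divn_small ?addr0 //.
exact: ltn_ord.
Qed.

Lemma Qd_addN : left_inverse ((0, 0) : V) Qd_opp Qd_add.
Proof.
case=> x i; rewrite /Qd_add /Qd_opp; congr (_, _) => /=; last exact: addNr.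
have [->|i0] := eqVneq i 0; first by rewrite /= modnn div0n mulr0n; abel.
have i0' : (0 < i)%N by rewrite lt0n -val_eqE in i0 *.
rewrite modn_small ?ltn_subrL ?i0' // subnK ?divnn; last exact: ltnW.
by rewrite !mulr1n; abel.
Qed.

HB.instance Definition _ := GRing.isZmodule.Build V Qd_addA Qd_addC Qd_add0 Qd_addN.

Definition Qd_a : V := (1, 0).
Definition Qd_b : V := (0, 1).

Lemma Qd_addE (u v : V) :
  u + v = (u.1 + v.1 + r *+ ((u.2 + v.2)%N %/ M), u.2 + v.2) :> V.
Proof. by []. Qed.

Lemma Qd_mulrn_snd (u : V) k : (u *+ k).2 = u.2 *+ k.
Proof. by elim: k => // k IH; rewrite !mulrS -IH. Qed.

Lemma Qd_mulrz_snd (u : V) k : (u *~ k).2 = u.2 *~ k.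
Proof.
case: k => k; first by rewrite -!pmulrn Qd_mulrn_snd.
by rewrite !NegzE !mulrNz -!pmulrn -Qd_mulrn_snd.
Qed.

Lemma Qd_row (x y : 'Z_n) : ((x, 0) : V) + ((y, 0) : V) = (x + y, 0).
Proof. apply: etrans (Qd_addE _ _) _; by rewrite /= addn0 div0n mulr0n !addr0. Qed.

Lemma Qd_mul_a p : Qd_a *+ p = (p%:R, 0).
Proof. by elim: p => // p IH; rewrite mulrSr IH -natr1 -Qd_row. Qed.

Lemma val_Zp_nat d k : ((k%:R : 'Z_d) : nat) = (k %% (Zp_trunc d).+2)%N.
Proof. by rewrite Zp_nat. Qed.

Lemma Qd_mul_b q : Qd_b *+ q = (r *+ (q %/ M), q%:R).
Proof.
elim: q => [|q IH]; first by rewrite div0n.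
rewrite mulrSr IH; apply: etrans (Qd_addE _ _) _.
rewrite [in LHS]/= addr0 -natr1; congr (_, _).
rewrite val_Zp_nat -mulrnDr [(1 %% M)%N]modn_small //.
by have := @carryA 0 q 1 M isT; rewrite !add0n => ->; rewrite addn1.
Qed.

Lemma Qd_coord p q :
  Qd_a *+ p + Qd_b *+ q = (p%:R + r *+ (q %/ M), q%:R) :> V.
Proof.
rewrite Qd_mul_a Qd_mul_b; apply: etrans (Qd_addE _ _) _.
rewrite [in LHS]/= add0r; congr (_, _).
by rewrite add0n [X in _ + r *+ X]divn_small ?mulr0n ?addr0 //; exact: ltn_ord.
Qed.

Lemma Zp_intr_eq0 d (k : int) : (1 < d)%N -> (k%:~R == 0 :> 'Z_d) = (d%:Z %| k)%Z.
Proof.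
move=> d1; have H j : (j%:R == 0 :> 'Z_d) = (d %| j)%N.
  by rewrite -val_eqE /= val_Zp_nat Zp_cast.
case: k => k; first by rewrite -pmulrn H.
by rewrite NegzE mulrNz oppr_eq0 rpredN -pmulrn H.
Qed.

Hypotheses (m1 : (1 < m)%N) (n1 : (1 < n)%N).

Lemma Qd_grid : grid Qd_a Qd_b m n r.
Proof.
split=> //.
- case=> x i; exists x, i; rewrite Qd_coord !natr_Zp divn_small ?ltn_ord //.
  by rewrite mulr0n addr0.
- have H j : (Qd_a *+ j = 0) <-> (n %| j)%N.
    have E : (j%:R == 0 :> 'Z_n) = (n %| j)%N := Zp_intr_eq0 j n1.
    by rewrite Qd_mul_a -E; split=> [/(congr1 fst)/eqP|/eqP -> //].
  case=> k; first by rewrite -pmulrn.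
  rewrite NegzE mulrNz rpredN -pmulrn; split=> [/eqP|/H -> //]; last exact: oppr0.
  by rewrite oppr_eq0 => /eqP /H.
- rewrite Qd_mul_a Qd_mul_b natr_Zp Zp_cast // divnn (ltnW m1) mulr1n.
  by congr (_, _); apply/eqP; rewrite (Zp_intr_eq0 m m1) dvdzz.
- move=> p q /(congr1 snd); rewrite !Qd_mulrz_snd mul0rz => /eqP.
  by rewrite Zp_intr_eq0.
Qed.

(** At i = m the carry in the coordinates of m b is exactly the shift by r that the gluing makes. *)
Lemma Qd_glueE (x : 'Z_n) (i : 'I_m.+1) :
  Qd_glue r (x, i) = Qd_a *+ x + Qd_b *+ i :> V.
Proof.
rewrite Qd_coord natr_Zp /Qd_glue [_.1]/= [_.2]/=; congr (_, _).
  have := ltn_ord i; rewrite ltnS leq_eqVlt.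
  case: eqP => [-> _|_ /= im].
    by rewrite [X in (_ %/ X)%N]Zp_cast // divnn (ltnW m1) mulr1n.
  by rewrite divn_small ?mulr0n ?addr0 // [X in (_ < X)%N]Zp_cast.
by rewrite Zp_nat.
Qed.

Lemma Qd_edge (u v : V) : @edge (Qd m r) u v = (v - u \in steps Qd_a Qd_b).
Proof.
have rowS (x : 'Z_n) : Qd_a *+ (x + 1)%R = Qd_a *+ x + Qd_a :> V.
  by rewrite !Qd_mul_a !natr_Zp Qd_row.
apply/idP/idP.
  case/andP=> _ /existsP[[x i] /existsP[[y j] /and3P[/eqP <- /eqP <-]]].
  rewrite !Qd_glueE /= /cartesian_edge /= => /orP[] /andP[/eqP].
    move=> -> /orP[] /eqP ->; rewrite mulrSr.
      by rewrite (_ : _ - _ = Qd_b) ?mem_steps_r //; abel.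
    by rewrite (_ : _ - _ = - Qd_b) ?steps_opp ?mem_steps_r //; abel.
  move=> -> /orP[] /eqP ->; rewrite rowS.
    by rewrite (_ : _ - _ = Qd_a) ?mem_steps_l //; abel.
  by rewrite (_ : _ - _ = - Qd_a) ?steps_opp ?mem_steps_l //; abel.
have edgeP (p q : 'Z_n * 'I_m.+1) :
    @edge (cartesian_product (cycle_graph n) (path_graph m)) p q ->
    @edge (Qd m r) (Qd_glue r p) (Qd_glue r q).
  move=> pq; apply/andP; split; first exact: Qd_no_loops.
  by apply/existsP; exists p; apply/existsP; exists q; rewrite !eqxx.
have coordP (w : V) : exists x : 'Z_n, exists2 i : nat, (i < m)%N &
    w = Qd_a *+ x + Qd_b *+ i.
  case: w => x i; exists x, i; first by rewrite -[X in (_ < X)%N]Zp_cast.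
  by rewrite Qd_coord !natr_Zp divn_small ?ltn_ord // mulr0n addr0.
have edge_a (w : V) : @edge (Qd m r) w (w + Qd_a).
  have [x [i im ->]] := coordP w; have im' : (i < m.+1)%N by apply: leqW.
  rewrite addrAC -rowS.
  have := @edgeP (x, Ordinal im') (x + 1, Ordinal im'); rewrite !Qd_glueE; apply.
  by rewrite /= /cartesian_edge /= eqxx /cycle_edge eqxx orbT.
(* Since i < m, level i + 1 still exists in the path, even when it equals m; the gluing does the
   wrapping. *)
have edge_b (w : V) : @edge (Qd m r) w (w + Qd_b).
  have [x [i im ->]] := coordP w; have im' : (i < m.+1)%N by apply: leqW.
  rewrite -addrA -mulrSr.
  have := @edgeP (x, Ordinal im') (x, Ordinal (im : (i.+1 < m.+1)%N)).
  rewrite !Qd_glueE; apply.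
  by rewrite /= /cartesian_edge /= eqxx /path_edge eqxx.
have uv d : v - u = d -> v = u + d by move=> <-; abel.
have vu d : v - u = - d -> u = v + d by move=> E; abel_from E.
case/stepsP=> E.
- by rewrite (uv _ E); apply: edge_a.
- by rewrite edge_sym (vu _ E); apply: edge_a.
- by rewrite (uv _ E); apply: edge_b.
- by rewrite edge_sym (vu _ E); apply: edge_b.
Qed.

End QdGroup.

(** * Instability and two-fold automorphisms *)

Lemma isomorphic_refl X : isomorphic X X.
Proof. by exists id => //; exists id. Qed.

Lemma isomorphic_sym X Y : isomorphic X Y -> isomorphic Y X.
Proof.
case=> g [h gK hK] ge; exists h; first by exists g.
by move=> u v; rewrite -ge !hK.
Qed.

Definition twofold_graph (X : sgraph) (f : bool -> X -> X) :=
  (forall e, injective (f e)) /\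
  (forall e u v, edge (f (~~ e) v) (f e u) = edge v u).

Lemma unstable_of_twofold (X : sgraph) (f : bool -> X -> X) :
  twofold_graph f -> ~ (forall u, f true u = f false u) -> ~ stable X.
Proof.
move=> [fi fe] nf st; apply: nf.
have inj : injective (fun u : X * bool => (f u.2 u.1, u.2)).
  by move=> [u i] [v j] /= [E ij]; move: E; rewrite ij => /fi ->.
have : perm inj \in graph_aut (double_cover X).
  rewrite inE; apply/forallP => -[u i]; apply/forallP => -[v j]; apply/eqP.
  rewrite !permE /= /double_cover_edge /=.
  by case: i; case: j => //=; [have := fe false v u|have := fe true v u];
    rewrite edge_sym [RHS]edge_sym.
rewrite st => /imset2P[s t _ _ E] u.
have Ei i : f i u = s u.
  by have := congr1 (fun p : {perm X * bool} => (p (u, i)).1) E; rewrite !permE.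
by rewrite !Ei.
Qed.

Lemma twofold_of_unstable (X : sgraph) : graph_connected X -> ~ bipartite X ->
  ~ stable X -> exists2 f : bool -> X -> X, twofold_graph f &
    ~ (forall u, f true u = f false u).
Proof.
move=> conn nbip nst.
have sub : aut_times_S2 X \subset graph_aut (double_cover X).
  apply/subsetP => p /imset2P[s t]; rewrite inE => /forallP sA _ ->.
  rewrite inE; apply/forallP => -[u i]; apply/forallP => -[v j].
  rewrite !permE /= /double_cover_edge /= (inj_eq perm_inj).
  by have /forallP /(_ v) /eqP -> := sA u.
have [sub'|/subsetPn[s sA sN]] := boolP (graph_aut (double_cover X) \subset aut_times_S2 X).
  by case: nst; apply/eqP; rewrite eqEsubset sub' sub.
have {}sA u v : double_cover_edge (s u) (s v) = double_cover_edge u v.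
  by move: sA; rewrite inE => /forallP/(_ u)/forallP/(_ v)/eqP.
(* [c i u] records whether s moves (u, i) to the other layer; it is constant along edges of the
   double cover. *)
pose c i u := (s (u, i)).2 (+) i.
have cE i u v : edge u v -> c i u = c (~~ i) v.
  move=> uv; have := sA (u, i) (v, ~~ i); rewrite /double_cover_edge /= uv andbT /c.
  rewrite (_ : i != ~~ i); last by case: i.
  by move=> /andP[]; case: (s _).2; case: (s _).2; case: i.
(* If the two copies of one vertex behave differently, connectedness propagates this to all
   vertices, and [c false] becomes a proper 2-colouring. *)
have cc u : c false u = c true u.
  apply/eqP/negPn/negP => cu; apply: nbip; exists (c false) => v w vw.
  have cl : closed (@edge X) [pred w | c false w != c true w].
    by move=> x y xy; rewrite !inE (cE _ _ _ xy) (cE true _ _ xy) eq_sym.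
  have := closed_connect cl (conn u w); rewrite !inE cu => /esym.
  by rewrite (cE _ _ _ vw) eq_sym.
have ccc u v : c false u = c false v.
  have cl : closed (@edge X) (c false).
    by move=> x y xy; rewrite -!topredE /= (cE _ _ _ xy) cc.
  by have := closed_connect cl (conn u v).
have [k kP] : exists k, forall i u, (s (u, i)).2 = i (+) k.
  have [u0 _|X0] := pickP (fun _ : X => true); last first.
    by exists false => i u; have := X0 u.
  exists (c false u0) => i u; rewrite -(ccc u).
  have -> : c false u = c i u by case: i.
  by rewrite /c; case: (s _).2; case: i.
exists (fun i u => (s (u, i)).1).
  split=> [i u v E|i u v].
    have : s (u, i) = s (v, i) by apply: injective_projections => //; rewrite !kP.
    by move=> /perm_inj [].
  have := sA (v, ~~ i) (u, i); rewrite /double_cover_edge /= !kP.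
  by case: i; case: (k).
move=> E; move/negP: sN; apply; apply/imset2P.
have inj : injective (fun u => (s (u, false)).1).
  move=> u v uv; have : s (u, false) = s (v, false).
    by apply: injective_projections => //; rewrite !kP.
  by move=> /perm_inj [].
have injk : injective (fun i => i (+) k) by case=> -[]; case: (k).
exists (perm inj) (perm injk); rewrite ?inE //.
  apply/forallP => u; apply/forallP => v; rewrite !permE -(E v).
  by have := sA (u, false) (v, true); rewrite /double_cover_edge /= !kP; case: (k) => /= ->.
apply/permP => -[u i]; rewrite !permE /=.
by apply: injective_projections; rewrite /= ?kP //; case: i.
Qed.

Lemma nontrivially_unstable_iso (X Y : sgraph) : isomorphic X Y -> graph_connected X ->
  nontrivially_unstable Y -> nontrivially_unstable X.
Proof.
move=> [g [h gK hK] ge] cX [uY cY nY tY]; split=> //.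
- have [f [fi fe] nf] := twofold_of_unstable cY nY uY.
  apply: (@unstable_of_twofold _ (fun e u => h (f e (g u)))); last first.
    by move=> E; apply: nf => y; apply: (can_inj hK); rewrite -(hK y).
  split=> [e u v /(can_inj hK)/fi/(can_inj gK) //|e u v].
  by rewrite -ge !hK fe ge.
- by move=> [c cP]; apply: nY; exists (c \o h) => u v uv; apply: cP; rewrite -ge !hK.
- move=> [u [v [uv E]]]; apply: tY; exists (g u), (g v); split.
    by move=> /(can_inj gK).
  by move=> w; rewrite -(hK w) !ge.
Qed.

(** * Instability of the two families *)

(** Translation by b - a exchanges a with b and -a with -b; this is the source of twins. *)
Lemma steps_shift (G : zmodType) (a b w : G) : b + b = a + a ->
  (w - (b - a) \in steps a b) = (w \in steps a b).
Proof.
move=> E; have H v : v \in steps a b -> v - (b - a) \in steps a b.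
  have -> : v - (b - a) = v + (b - a) by abel_from E.
  case/stepsP=> ->.
  - by rewrite (_ : _ + _ = b) ?mem_steps_r //; abel.
  - by rewrite (_ : _ + _ = - b) ?steps_opp ?mem_steps_r //; abel_from E.
  - by rewrite (_ : _ + _ = a) ?mem_steps_l //; abel_from E.
  - by rewrite (_ : _ + _ = - a) ?steps_opp ?mem_steps_l //; abel.
apply/idP/idP => [/H|/H //].
by rewrite (_ : _ - _ = w) //; abel_from E.
Qed.

Lemma steps_oppl (G : zmodType) (a b : G) : steps (- a) b =i steps a b.
Proof.
by move=> w; rewrite !inE opprK; case: (w == a); case: (w == - a).
Qed.

Lemma steps_swap_sign (G : zmodType) (a b : G) (e : int) : e = 1 \/ e = -1 ->
  steps b (a *~ e) =i steps a b.
Proof.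
move=> e1 w; rewrite -(steps_swap a b); case: e1 => ->; first by rewrite mulr1z.
by rewrite mulrN1z !inE opprK; case: (w == a); case: (w == - a).
Qed.

(** Twins differ by some d whose translation stabilises S. If a + d is not a, following -a, and if
    necessary b, yields 2 a = 0, 2 b = ±2 a or b as a multiple of a. *)
Lemma grid_twin_free (G : zmodType) (a b : G) (m n r : nat) (d : G) :
  grid a b m n r -> (2 < n)%N -> b + b <> a + a -> b + b <> - (a + a) ->
  (forall w, (w - d \in steps a b) = (w \in steps a b)) -> d = 0.
Proof.
move=> gr n2 tw twN Sd.
have a2 : a + a <> 0.
  by move/(grid_order_nat gr 2)/(dvdn_leq (isT : (0 < 2)%N)); rewrite leqNgt n2.
have nb k := grid_b_notin gr (p := k).
have S w : w \in steps a b -> w + d \in steps a b by move=> wS; rewrite -Sd addrK.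
have NaS : - a \in steps a b by rewrite steps_opp mem_steps_l.
have /stepsP H1 := S a (mem_steps_l a b).
have /stepsP H2 := S (- a) NaS.
have /stepsP H3 := S b (mem_steps_r a b).
case: H1 => E1; first by abel_from E1.
- case: H2 => E2.
  + case: H3 => E3.
    * by case: (nb 3); abel_from (congr2 (fun u v => u - v) E3 E1).
    * by case: (nb 1); abel_from (congr2 (fun u v => u - v) E3 E1).
    * by case: a2; abel_from (congr2 (fun u v => u - v) E3 E1).
    * by case: tw; abel_from (congr2 (fun u v => u - v) E3 E1).
  + by case: a2; abel_from (congr2 (fun u v => u - v) E2 E1).
  + by case: (nb (-3)); abel_from (congr2 (fun u v => u - v) E2 E1).
  + by case: (nb 3); abel_from (congr2 (fun u v => u - v) E2 E1).
- case: H2 => E2.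
  + by case: (nb 3); abel_from (congr2 (fun u v => u - v) E2 E1).
  + by case: (nb 1); abel_from (congr2 (fun u v => u - v) E2 E1).
  + by case: a2; abel_from (congr2 (fun u v => u - v) E2 E1).
  + by case: tw; abel_from (congr2 (fun u v => u - v) E2 E1).
- case: H2 => E2.
  + by case: (nb (-3)); abel_from (congr2 (fun u v => u - v) E2 E1).
  + by case: (nb (-1)); abel_from (congr2 (fun u v => u - v) E2 E1).
  + by case: twN; abel_from (congr2 (fun u v => u - v) E2 E1).
  + by case: a2; abel_from (congr2 (fun u v => u - v) E2 E1).
Qed.

Lemma surj_inj (T : finType) (g : T -> T) : (forall y, exists x, g x = y) -> injective g.
Proof.
move=> gs; have [h hK] := fin_all_exists gs.
have [h' hh' h'h] := injF_bij (can_inj hK).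
by move=> x y; rewrite -[x]h'h -[y]h'h !hK => ->.
Qed.

(** f e x is read off an arbitrary walk of parity e from 0 to x; preservation of even relations
    makes the choice immaterial. Lifting walks gives surjectivity, and finiteness then gives
    injectivity. *)
Lemma twofold_construct (G : finZmodType) (a b A B : G) :
  parity_generated a b -> steps A B =i steps a b ->
  (forall p q p' q', a *+ p + b *+ q = a *+ p' + b *+ q' ->
     odd (p + q) = odd (p' + q') -> A *+ p + B *+ q = A *+ p' + B *+ q') ->
  exists2 f, twofold a b f &
    forall e p q, odd (p + q) = e -> f e (a *+ p + b *+ q) = A *+ p + B *+ q.
Proof.
move=> gen AB rel.
have [w wP] : exists w : bool * G -> nat * nat, forall ex,
    ex.2 = a *+ (w ex).1 + b *+ (w ex).2 /\ odd ((w ex).1 + (w ex).2) = ex.1.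
  apply: (@fin_all_exists (bool * G)%type (fun=> (nat * nat)%type) (fun ex u =>
    ex.2 = a *+ u.1 + b *+ u.2 /\ odd (u.1 + u.2) = ex.1)) => -[e x]; have [p [q E]] := gen e x.
  by exists (p, q).
pose f e x := A *+ (w (e, x)).1 + B *+ (w (e, x)).2.
have fE e p q : odd (p + q) = e -> f e (a *+ p + b *+ q) = A *+ p + B *+ q.
  by move=> pq; have [E o] := wP (e, a *+ p + b *+ q); apply: rel; rewrite ?o.
have fa e x : f (~~ e) (x + a) = f e x + A.
  have [p [q [-> o]]] := gen e x; rewrite (fE _ _ _ o) addrAC -mulrSr fE ?addSn /= ?o //.
  by rewrite mulrSr addrAC.
have fb e x : f (~~ e) (x + b) = f e x + B.
  have [p [q [-> o]]] := gen e x; rewrite (fE _ _ _ o) -addrA -mulrSr fE ?addnS /= ?o //.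
  by rewrite mulrSr addrA.
have fNa e x : f (~~ e) (x - a) = f e x - A.
  by have := fa (~~ e) (x - a); rewrite negbK subrK => ->; rewrite addrK.
have fNb e x : f (~~ e) (x - b) = f e x - B.
  by have := fb (~~ e) (x - b); rewrite negbK subrK => ->; rewrite addrK.
have img e x s : s \in steps a b -> exists y, f (~~ e) y = f e x + s.
  rewrite -AB => /stepsP[] ->; [exists (x + a)|exists (x - a)|exists (x + b)|exists (x - b)];
    by [exact: fa|exact: fNa|exact: fb|exact: fNb].
have fsurj e y : exists x, f e x = y.
  have [p [q [yE o]]] := gen false (y - f e 0).
  suff [x xE] : exists x, f (e (+) odd (p + q)) x = f e 0 + a *+ p + b *+ q.
    by exists x; move: xE; rewrite o addbF -addrA -yE => ->; abel.
  elim: q {yE o} => [|q [x xE]].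
    rewrite addn0 addr0; elim: p => [|p [x xE]]; first by exists 0; rewrite addbF addr0.
    have [z zE] := img (e (+) odd p) x a (mem_steps_l a b); exists z.
    by rewrite /= addbN zE xE mulrSr addrA.
  have [z zE] := img (e (+) odd (p + q)) x b (mem_steps_r a b); exists z.
  by rewrite addnS /= addbN zE xE mulrSr addrA.
have finj e : injective (f e) := surj_inj (fsurj e).
exists f => //; split=> // e x y; apply/idP/idP => [|/stepsP yx].
  rewrite -AB => /stepsP fyx.
  have back s S : f (~~ e) (x + s) = f e x + S -> f (~~ e) y - f e x = S -> y = x + s.
    by move=> E1 E2; apply: (finj (~~ e)); rewrite E1 -E2; abel.
  case: fyx => [/(back _ _ (fa e x))|/(back _ _ (fNa e x))|/(back _ _ (fb e x))
               |/(back _ _ (fNb e x))] ->; rewrite [x + _]addrC addrK ?steps_opp;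
    by [exact: mem_steps_l|exact: mem_steps_r].
have yE : y = x + (y - x) by abel.
by rewrite -AB yE; case: yx => ->; rewrite ?fa ?fNa ?fb ?fNb [f e x + _]addrC addrK
  ?steps_opp ?mem_steps_l ?mem_steps_r.
Qed.

Lemma twofold_nontrivial (G : zmodType) (a b A B : G) (f : bool -> G -> G) p q p' q' :
  (forall e p q, odd (p + q) = e -> f e (a *+ p + b *+ q) = A *+ p + B *+ q) ->
  a *+ p + b *+ q = a *+ p' + b *+ q' -> odd (p + q) != odd (p' + q') ->
  A *+ p + B *+ q <> A *+ p' + B *+ q' -> ~ (forall x, f true x = f false x).
Proof.
move=> fE E o ne eqf; apply: ne; rewrite -(fE _ _ _ erefl) -(fE _ _ _ erefl) E.
by case: (odd (p + q)) (odd (p' + q')) o => -[].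
Qed.

Lemma odd_eq_diff x y : odd x = odd y -> exists v : int, x%:Z - y%:Z = 2 * v.
Proof.
move=> o; exists (x./2%:Z - y./2%:Z).
by have := odd_double_half x; have := odd_double_half y; rewrite o; lia.
Qed.

Section WilsonUnstable.
Variables (G : finZmodType) (a b : G) (m n r : nat).
Hypothesis gr : grid a b m n r.

Let rel_nat p q p' q' : a *+ p + b *+ q = a *+ p' + b *+ q' ->
  exists t : int, q%:Z - q'%:Z = t * m%:Z /\ (n%:Z %| p%:Z - p'%:Z + t * r%:Z)%Z.
Proof. by move=> E; apply/(grid_rel gr); abel_from E. Qed.

Let twin_dvd (s : int) : b + b = a *~ (2 * s) -> m = 2%N /\ (n%:Z %| r%:Z - 2 * s)%Z.
Proof.
move=> E.
have m2 : m = 2%N.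
  have m2 : (m %| 2)%N by apply: (@grid_height _ _ _ _ _ _ gr (2 * s) 2); abel_from E.
  have := dvdn_leq (isT : (0 < 2)%N) m2; have := grid_m gr.
  by case: (m) => [|[|[|k]]].
split=> //; apply/(grid_order gr); have := grid_glue gr; rewrite m2 => F.
by abel_from (congr2 (fun u v => u - v) E F).
Qed.

Lemma wilson1_twofold : wilson1 m n r -> [/\ nonbip_grid m n r, (2 < n)%N,
  b + b <> a + a, b + b <> - (a + a) &
  exists2 f, twofold a b f & ~ (forall x, f true x = f false x)].
Proof.
case=> k [nE [omk rk]].
have k0 : (0 < k)%N by have := grid_n gr; rewrite nE; case: (k).
have [i [s [s1 rE]]] : exists i s : int, (s = 1 \/ s = -1) /\
    r%:Z = s * k%:Z + 4 * k%:Z * i.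
  case: rk => /dvdzP[i E]; exists i.
    by exists 1; split; [left|rewrite -[LHS](subrK k%:Z) E nE PoszM; ring].
  by exists (-1); split; [right|rewrite -[LHS](addrK k%:Z) E nE PoszM; ring].
have rk2 : odd r = odd k.
  case: s1 rE => ->; rewrite -mulrA; set y := k%:Z * i; clearbody y; clear; lia.
have orm : odd (r + m) by rewrite oddD rk2 addbC -oddD.
have en : ~~ odd n by rewrite nE oddM.
have nb : nonbip_grid m n r by rewrite /nonbip_grid orm orbT.
have tw (u : int) : odd `|u| -> b + b <> a *~ (2 * u).
  move=> ou /twin_dvd[m2 /dvdzP[z E]].
  have om : odd r by move: orm; rewrite m2 addn2 /= negbK.
  move: om E; rewrite nE PoszM; clear; set w := z * _.
  have -> : w = 4 * (z * k%:Z) by rewrite /w; ring.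
  by set y := z * k; clearbody y; clear; lia.
split=> //.
- by rewrite nE; move: k0; clear; lia.
- by move=> E; apply: (tw 1 isT); abel_from E.
- by move=> E; apply: (tw (-1) isT); abel_from E.
have [p q p' q' E o|f tf fE] :=
  twofold_construct (grid_parity_generated gr nb) (steps_oppl a b).
  have [t [qE /dvdzP[j pE]]] := rel_nat E.
  suff : a *~ (2 * (p%:Z - p'%:Z)) = 0 by move=> F; abel_from (congr2 (fun u v => u - v) E F).
  apply/(grid_order gr)/dvdzP.
  have [v vE] := odd_eq_diff o; have [u uE] : exists u, (m + r = 2 * u + 1)%N.
    by exists (r + m)./2; move: orm; clear; lia.
  (* As n is even and r + m odd, an even relation involves the glue relation an even number t of
     times, which makes 2 t r a multiple of 4 k. *)
  have [t2 tE] : exists t2, t = 2 * t2.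
    exists (v - 2 * j * k%:Z - t * u%:Z + t * r%:Z).
    have mE : m%:Z = 2 * u%:Z + 1 - r%:Z by move: uE; clear; lia.
    have -> : t = t * m%:Z - t * (m%:Z - 1) by ring.
    have pE' : p%:Z - p'%:Z = j * n%:Z - t * r%:Z by rewrite -pE; ring.
    have vE' : 2 * v = p%:Z - p'%:Z + (q%:Z - q'%:Z) by rewrite -vE !PoszD; ring.
    by rewrite !mulrDr vE' pE' qE mE nE PoszM; ring.
  exists (2 * j - t2 * (s + 4 * i)).
  have -> : p%:Z - p'%:Z = j * n%:Z - t * r%:Z by rewrite -pE; ring.
  by rewrite rE tE nE PoszM; ring.
(* The glue relation is odd, and -r a = m b would force n to divide 2 r, although r is an odd
   multiple of n / 4. *)
exists f => //; apply: (twofold_nontrivial (p := r) (q := 0) (p' := 0) (q' := m) fE).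
- by rewrite !mulr0n addr0 add0r (grid_glue gr).
- by move: orm; rewrite addn0 add0n oddD; case: odd; case: odd.
rewrite !mulr0n addr0 add0r (grid_glue gr) => E.
have /(grid_order gr)/dvdzP[j jE] : a *~ (2 * r%:Z) = 0 by abel_from E.
have : k%:Z * (s + 4 * i - 2 * j) = 0.
  have -> : k%:Z * (s + 4 * i - 2 * j) = s * k%:Z + 4 * k%:Z * i - 2 * k%:Z * j by ring.
  rewrite -rE; move: jE; rewrite nE PoszM (_ : j * _ = 4 * (k%:Z * j)); last by ring.
  by rewrite -mulrA; set y := k%:Z * j; clearbody y; clear; lia.
move/eqP; rewrite mulf_eq0 => /orP[]; first by move: k0; clear; lia.
by case: s1 => ->; clear; lia.
Qed.

Lemma wilson2_twofold (h k : nat) (l e : int) :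
  m = (2 * h)%N -> n = (k * h)%N -> odd h -> e = 1 \/ e = -1 ->
  (k%:Z %| 4 * l ^+ 2 - e)%Z -> (n%:Z %| r%:Z - 4 * l * h%:Z)%Z ->
  (1 < h)%N \/ ~~ (k%:Z %| 2 * l - 1)%Z /\ ~~ (k%:Z %| 2 * l + 1)%Z ->
  [/\ nonbip_grid m n r, (2 < n)%N, b + b <> a + a, b + b <> - (a + a) &
  exists2 f, twofold a b f & ~ (forall x, f true x = f false x)].
Proof.
move=> mE nE oh e1 /dvdzP[c cE] /dvdzP[i iE] ht.
have ok : odd k.
  have : odd `|c * k%:Z|.
    by rewrite -cE; case: e1 => ->; set y := l ^+ 2; clearbody y; clear; lia.
  by rewrite abszM oddM => /andP[].
have on : odd n by rewrite nE oddM ok.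
have nb : nonbip_grid m n r by rewrite /nonbip_grid on.
have tw (s : int) : s = 1 \/ s = -1 -> b + b <> a *~ (2 * s).
  move=> s1 /twin_dvd[m2 /dvdzP[j jE]].
  have h1 : h = 1%N by move: mE; rewrite m2; clear; lia.
  have ks : (k%:Z %| 2 * l - s)%Z.
    rewrite -(@Gauss_dvdzr k%:Z 2); last by rewrite coprimezE; exact: etrans (coprimen2 k) ok.
    apply/dvdzP; exists (j - i); rewrite mulrBl.
    move: iE jE; rewrite nE h1 muln1 => <- <-; ring.
  case: ht; first by rewrite h1.
  by move=> [/negP N1 /negP N2]; case: s1 => sE; rewrite sE ?opprK in ks; [case: N1|case: N2].
have rE : r%:Z = 4 * l * h%:Z + i * n%:Z by rewrite -iE; ring.
split=> //.
- by have := grid_n gr; move: on; clear; case: (n) => [|[|[|]]].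
- by move=> E; apply: (tw 1); [left|abel_from E].
- by move=> E; apply: (tw (-1)); [right|abel_from E].
have [p q p' q' E o|f tf fE] := 
  twofold_construct (grid_parity_generated gr nb) (steps_swap_sign a b e1).
  have [t [qE /dvdzP[j pE]]] := rel_nat E.
  suff : b *~ (p%:Z - p'%:Z) + a *~ (e * (q%:Z - q'%:Z)) = 0 by move=> F; abel_from F.
  have [v vE] := odd_eq_diff o; have pE' : p%:Z - p'%:Z = j * n%:Z - t * r%:Z.
    by rewrite -pE; ring.
  (* Modulo 2 the difference of lengths of the two walks is h k (j - t i), with h and k odd. *)
  have [x xE] : exists x, j - t * i = 2 * x.
    have : ~~ odd `|h%:Z * (k%:Z * (j - t * i))|.
      have -> : h%:Z * (k%:Z * (j - t * i)) = 2 * (v + 2 * t * l * h%:Z - t * h%:Z).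
        have -> : 2 * (v + 2 * t * l * h%:Z - t * h%:Z) =
           2 * v + 4 * t * l * h%:Z - 2 * t * h%:Z by ring.
        have -> : 2 * v = p%:Z - p'%:Z + (q%:Z - q'%:Z) by rewrite -vE !PoszD; ring.
        by rewrite pE' qE rE mE nE !PoszM; ring.
      by rewrite abszM oddM.
    rewrite !abszM !oddM oh ok /=; set y := j - t * i => oy.
    by exists (y %/ 2)%Z; move: oy; clearbody y; clear; lia.
  have -> : p%:Z - p'%:Z = (k%:Z * x - 2 * t * l) * m%:Z.
    have -> : p%:Z - p'%:Z = (j - t * i) * n%:Z - 4 * t * l * h%:Z.
      by rewrite pE' rE; ring.
    by rewrite xE mE nE !PoszM; ring.
  have -> : b *~ ((k%:Z * x - 2 * t * l) * m%:Z) = a *~ ((k%:Z * x - 2 * t * l) * r%:Z).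
    by rewrite !(mulrC (_ - _)) !mulrzA -!pmulrn (grid_glue gr).
  rewrite -mulrzDr; apply/(grid_order gr)/dvdzP.
  exists (4 * l * x + i * (k%:Z * x - 2 * t * l) - 2 * t * c).
  have -> : (k%:Z * x - 2 * t * l) * r%:Z + e * (q%:Z - q'%:Z) =
     k%:Z * h%:Z * (4 * l * x) + i * n%:Z * (k%:Z * x - 2 * t * l)
       - 2 * t * h%:Z * (4 * l ^+ 2 - e) by rewrite rE qE mE !PoszM; ring.
  by rewrite cE nE PoszM; ring.
(* The odd relation n a = 0 is not preserved: n b = 0 would make the even m divide the odd n. *)
exists f => //; apply: (twofold_nontrivial (p := n) (q := 0) (p' := 0) (q' := 0) fE).
- by rewrite !mulr0n; apply/eqP; rewrite !addr0; apply/eqP/(grid_order_nat gr).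
- by rewrite addn0 on.
rewrite !mulr0n !addr0 => E.
have : (m %| n)%N by apply: (@grid_height _ _ _ _ _ _ gr 0 n); rewrite -pmulrn E.
by rewrite mE => /dvdn_odd /(_ on); rewrite oddM.
Qed.

End WilsonUnstable.

(** * The toroidal grids *)

Section QdInstability.
Variables (m n : nat) (r : 'Z_n).
Hypotheses (m1 : (1 < m)%N) (n1 : (1 < n)%N).
Notation V := (QdG m r).
Notation a := (Qd_a m r).
Notation b := (Qd_b m r).
Let gr := Qd_grid r m1 n1.

Lemma Qd_edge_step (u s : V) : s \in steps a b -> @edge (Qd m r) u (u + s).
Proof. by move=> sS; rewrite Qd_edge // (_ : _ - _ = s) //; abel. Qed.

Lemma Qd_connected : graph_connected (Qd m r).
Proof.
suff H (u v : V) : connect (@edge (Qd m r)) u v by [].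
have [p [q E]] := grid_gen gr (v - u).
have -> : v = u + a *+ p + b *+ q by rewrite -addrA -E; abel.
have step (w s : V) k : s \in steps a b -> connect (@edge (Qd m r)) w (w + s *+ k).
  move=> sS; elim: k => [|k IH]; first by rewrite mulr0n addr0.
  by rewrite mulrSr addrA; apply: connect_trans IH (connect1 (Qd_edge_step _ sS)).
exact: connect_trans (step _ _ _ (mem_steps_l a b)) (step _ _ _ (mem_steps_r a b)).
Qed.

Lemma Qd_not_bipartite : nonbip_grid m n r -> ~ bipartite (Qd m r).
Proof.
move=> /(grid_odd_rel gr)[p [q [E o]]] [c cP].
have cS (w s : V) : s \in steps a b -> c (w + s) = ~~ c w.
  move=> sS; have : c w != c (w + s) by apply: cP; apply: Qd_edge_step.
  by case: (c w); case: (c (w + s)).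
have flip (w s : V) k : s \in steps a b -> c (w + s *+ k) = c w (+) odd k.
  move=> sS; elim: k => [|k IH]; first by rewrite mulr0n addr0 addbF.
  by rewrite mulrSr addrA cS // IH /= addbN.
have := flip 0 a p (mem_steps_l a b); rewrite E (flip 0 b q (mem_steps_r a b)).
by move: o; rewrite oddD; case: (c 0); case: (odd p); case: (odd q).
Qed.

Lemma odd_Zp_add d (x y : 'Z_d) : (1 < d)%N -> ~~ odd d ->
  odd (x + y)%R = odd x (+) odd y.
Proof.
move=> d1 ed; rewrite -oddD /= [X in (_ %% X)%N]Zp_cast // [in RHS](divn_eq (x + y) d).
by rewrite oddD oddM (negbTE ed) andbF.
Qed.

(** As n is even, parity is additive on Z_n. Wrapping the second coordinate removes m and adds r to
    the first, and r + m is even. *)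
Lemma Qd_bipartite : ~~ nonbip_grid m n r -> bipartite (Qd m r).
Proof.
rewrite /nonbip_grid negb_or => /andP[en erm].
have odd1 d : odd (1%R : 'Z_d) by [].
pose c (u : V) := odd u.1 (+) odd u.2.
have ca (u : V) : c (u + a) = ~~ c u.
  rewrite /c -[u + a]/((u.1 + 1 + r *+ ((u.2 + 0)%N %/ (Zp_trunc m).+2), u.2 + 0) : V).
  rewrite [(_, _).1]/= [(_, _).2]/= addn0 divn_small ?ltn_ord // mulr0n !addr0.
  by rewrite odd_Zp_add // odd1 addbT addNb.
have cb (u : V) : c (u + b) = ~~ c u.
  rewrite /c -[u + b]/((u.1 + 0 + r *+ ((u.2 + 1)%N %/ (Zp_trunc m).+2), u.2 + 1) : V).
  rewrite [(_, _).1]/= [(_, _).2]/= addr0 odd_Zp_add //.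
  have i_lt : (u.2 < m)%N by rewrite -[X in (_ < X)%N](Zp_cast m1).
  have -> : ((u.2 + 1)%R : nat) = ((u.2 + 1) %% m)%N.
    by rewrite /= [X in (_ %% X)%N]Zp_cast // [X in (_ + X)%N]modn_small.
  rewrite [X in (_ %/ X)%N]Zp_cast //; have [im|im] := ltnP (u.2 + 1)%N m.
    by rewrite divn_small // modn_small // mulr0n addbF addn1 /= addbN.
  have -> : (u.2 + 1)%N = m by move: i_lt im; clear; lia.
  rewrite divnn modnn (ltnW m1) mulr1n /= addbF.
  have : odd u.2 = ~~ odd m by move: i_lt im; clear; lia.
  by move=> ->; move: erm; rewrite oddD; case: (odd r); case: (odd m); case: (odd u.1).
exists c; suff H (u v : V) : @edge (Qd m r) u v -> c u != c v by [].
rewrite Qd_edge // => uv; rewrite -[v](subrK u) addrC.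
have ca' (w : V) : c (w - a) = ~~ c w by rewrite -[in RHS](subrK a w) ca negbK.
have cb' (w : V) : c (w - b) = ~~ c w by rewrite -[in RHS](subrK b w) cb negbK.
by case/stepsP: uv => ->; rewrite ?ca ?cb ?ca' ?cb'; case: (c u).
Qed.

Lemma Qd_twofold f : twofold_graph (X := Qd m r) f <-> twofold a b f.
Proof.
split=> [[fi fe]|[fi fs fa]].
  split=> // [e y|e x y]; last by rewrite -!Qd_edge // edge_sym fe edge_sym.
  by have [g fg gf] := injF_bij (fi e); exists (g y).
by split=> // e u v; rewrite edge_sym [RHS]edge_sym !Qd_edge // fa.
Qed.

Lemma Qd_unstable_only : nontrivially_unstable (Qd m r) ->
  [/\ nonbip_grid m n r, b + b <> a + a, b + b <> - (a + a) &
    exists2 f, twofold a b f & ~ (forall x, f true x = f false x)].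
Proof.
case=> un conn nbip ntw; split.
- by apply/negPn/negP => /Qd_bipartite.
- move=> E; apply: ntw; exists (0 : V), (b - a).
  have ne : (0 : V) <> b - a.
    by move=> F; apply: (@grid_b_notin _ _ _ _ _ _ gr 1); abel_from F.
  split; first exact: ne.
  by move=> w; rewrite !Qd_edge // subr0 steps_shift.
- move=> E; apply: ntw; exists (0 : V), (b - - a).
  have ne : (0 : V) <> b - - a.
    by move=> F; apply: (@grid_b_notin _ _ _ _ _ _ gr (-1)); abel_from F.
  split; first exact: ne.
  move=> w; rewrite !Qd_edge // subr0 -!(steps_oppl a b) steps_shift //.
  by abel_from E.
- by have [f /Qd_twofold tf nf] := twofold_of_unstable conn nbip un; exists f.
Qed.

Lemma Qd_unstable_if : [/\ nonbip_grid m n r, (2 < n)%N,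
    b + b <> a + a, b + b <> - (a + a) &
    exists2 f, twofold a b f & ~ (forall x, f true x = f false x)] ->
  nontrivially_unstable (Qd m r).
Proof.
case=> nb n2 tw twN [f /Qd_twofold tf nf]; split.
- exact: unstable_of_twofold tf nf.
- exact: Qd_connected.
- exact: Qd_not_bipartite.
- suff H (u v : V) : @edge (Qd m r) u =1 @edge (Qd m r) v -> u = v.
    by move=> [u [v [uv E]]]; apply/uv/H.
  move=> E; suff F : v - u = 0 by abel_from F.
  apply: (grid_twin_free gr n2 tw twN) => w.
  have := E (w + u); rewrite !Qd_edge // => F.
  by rewrite (_ : w - (v - u) = w + u - v); [rewrite -F addrK|abel].
Qed.

End QdInstability.

(** * Isomorphism between the two forms of family (2) *)

(** p a1 + q b1 -> p A + q B respects the generating relations and is onto because ±A, ±B are all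
    the steps of G2; equal cardinals make it bijective. *)
Lemma grid_iso (G1 G2 : finZmodType) (a1 b1 : G1) (a2 b2 A B : G2) m n r :
  grid a1 b1 m n r -> (forall x, exists p q, x = a2 *+ p + b2 *+ q) ->
  A *+ n = 0 -> B *+ m = A *+ r -> steps A B =i steps a2 b2 -> #|G1| = #|G2| ->
  exists2 g : G1 -> G2, bijective g &
    forall x y, (g y - g x \in steps a2 b2) = (y - x \in steps a1 b1).
Proof.
move=> gr gen An Bm AB card.
have rel p q p' q' : a1 *+ p + b1 *+ q = a1 *+ p' + b1 *+ q' ->
    A *+ p + B *+ q = A *+ p' + B *+ q'.
  move=> E; have [|t [qE /dvdzP[j pE]]] := (grid_rel gr (p%:Z - p'%:Z) (q%:Z - q'%:Z)).1.
    by abel_from E.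
  suff F : A *~ (p%:Z - p'%:Z) + B *~ (q%:Z - q'%:Z) = 0 by abel_from F.
  have -> : p%:Z - p'%:Z = n%:Z * j - r%:Z * t by rewrite mulrC -pE; ring.
  by rewrite qE (mulrC t) mulrzBr !mulrzA -!pmulrn An Bm mul0rz; abel.
have [w wP] : exists w : G1 -> nat * nat, forall x, x = a1 *+ (w x).1 + b1 *+ (w x).2.
  apply: (@fin_all_exists G1 (fun=> (nat * nat)%type)
    (fun x u => x = a1 *+ u.1 + b1 *+ u.2)) => x.
  by have [p [q E]] := grid_gen gr x; exists (p, q).
pose g x := A *+ (w x).1 + B *+ (w x).2.
have gE p q : g (a1 *+ p + b1 *+ q) = A *+ p + B *+ q by apply: rel; rewrite -wP.
have ga x : g (x + a1) = g x + A.
  have [p [q ->]] := grid_gen gr x; rewrite addrAC -mulrSr !gE.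
  by rewrite mulrSr addrAC.
have gb x : g (x + b1) = g x + B.
  have [p [q ->]] := grid_gen gr x; rewrite -addrA -mulrSr !gE.
  by rewrite mulrSr addrA.
have gNa x : g (x - a1) = g x - A by rewrite -[in RHS](subrK a1 x) ga addrK.
have gNb x : g (x - b1) = g x - B by rewrite -[in RHS](subrK b1 x) gb addrK.
have img x s : s \in steps a2 b2 -> exists y, g y = g x + s.
  rewrite -AB => /stepsP[] ->;
    [exists (x + a1)|exists (x - a1)|exists (x + b1)|exists (x - b1)];
    by [exact: ga|exact: gNa|exact: gb|exact: gNb].
have gsurj y : exists x, g x == y.
  have [p [q yE]] := gen (y - g 0).
  suff [x xE] : exists x, g x = g 0 + a2 *+ p + b2 *+ q.
    by exists x; apply/eqP; rewrite xE -addrA -yE; abel.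
  elim: q {yE} => [|q [x xE]].
    rewrite addr0; elim: p => [|p [x xE]]; first by exists 0; rewrite addr0.
    have [z zE] := img x a2 (mem_steps_l a2 b2); exists z.
    by rewrite zE xE mulrSr addrA.
  have [z zE] := img x b2 (mem_steps_r a2 b2); exists z.
  by rewrite zE xE mulrSr addrA.
have [h hK] : exists h, cancel h g.
  by exists (fun y => xchoose (gsurj y)) => y; apply/eqP/(xchooseP (gsurj y)).
have hb : bijective h by apply: inj_card_bij (can_inj hK) _; rewrite card.
have gbij : bijective g by apply: bij_can_bij hK.
exists g => // x y; apply/idP/idP => [|/stepsP yx].
  rewrite -AB => /stepsP gyx.
  have back s S : g (x + s) = g x + S -> g y - g x = S -> y = x + s.
    by move=> E1 E2; apply: (bij_inj gbij); rewrite E1 -E2; abel.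
  case: gyx => [/(back _ _ (ga x))|/(back _ _ (gNa x))|/(back _ _ (gb x))
               |/(back _ _ (gNb x))] ->; rewrite [x + _]addrC addrK ?steps_opp;
    by [exact: mem_steps_l|exact: mem_steps_r].
have yE : y = x + (y - x) by abel.
by rewrite -AB yE; case: yx => ->; rewrite ?ga ?gNa ?gb ?gNb [g x + _]addrC addrK
  ?steps_opp ?mem_steps_l ?mem_steps_r.
Qed.

Lemma Zp_intrP d (x : 'Z_d) (z : int) : (1 < d)%N ->
  x = z%:~R <-> (d%:Z %| (x : nat)%:Z - z)%Z.
Proof.
move=> d1; rewrite -Zp_intr_eq0 // mulrzBr -pmulrn natr_Zp subr_eq0.
by split=> /eqP.
Qed.

(** The directions are exchanged: the generators of the first group go to b and e a. In the second,
    k m b = 2 k l m a = 0, and the glue relation amounts to 2 m (4 l^2 - e) a = 0. *)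
Lemma Qd_double_iso (m k : nat) (l e : int) : (1 < m)%N -> (0 < k)%N ->
  e = 1 \/ e = -1 -> (k%:Z %| 4 * l ^+ 2 - e)%Z ->
  isomorphic (Qd (2 * m) ((4 * l * m%:Z)%:~R : 'Z_(k * m)))
             (Qd m ((2 * l * m%:Z)%:~R : 'Z_(2 * k * m))).
Proof.
move=> m1 k0 e1 /dvdzP[c cE].
have km1 : (1 < k * m)%N by apply: leq_trans m1 _; rewrite leq_pmull.
have m21 : (1 < 2 * m)%N by lia.
have km21 : (1 < 2 * k * m)%N by rewrite -mulnA; lia.
set r1 := (4 * l * m%:Z)%:~R; set r2 := (2 * l * m%:Z)%:~R.
have gr1 := Qd_grid r1 m21 km1; have gr2 := Qd_grid r2 m1 km21.
have /dvdzP[i iE] := (Zp_intrP r1 (4 * l * m%:Z) km1).1 erefl.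
have /dvdzP[j jE] := (Zp_intrP r2 (2 * l * m%:Z) km21).1 erefl.
have {}iE : (r1 : nat)%:Z = m%:Z * (4 * l + k%:Z * i).
  by rewrite -[LHS](subrK (4 * l * m%:Z)) iE PoszM; ring.
have {}jE : (r2 : nat)%:Z = 2 * l * m%:Z + (2 * k * m)%:Z * j.
  by rewrite -[LHS](subrK (2 * l * m%:Z)) jE; ring.
set a := Qd_a m r2 in gr2; set b := Qd_b m r2 in gr2.
have bm z : b *~ (m%:Z * z) = a *~ ((r2 : nat)%:Z * z).
  by rewrite !mulrzA -!pmulrn (grid_glue gr2).
have [|||g gb gE] := grid_iso gr1 (grid_gen gr2) _ _ (steps_swap_sign a b e1) _.
- rewrite pmulrn PoszM mulrC bm; apply/(grid_order gr2)/dvdzP.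
  by exists (l + k%:Z * j); rewrite jE !PoszM; ring.
- rewrite !pmulrn iE bm -mulrzA; apply/eqP; rewrite -subr_eq0 -mulrzBr; apply/eqP.
  apply/(grid_order gr2)/dvdzP; exists (- (l * i) - j * (4 * l + k%:Z * i) - c).
  have -> : e = 4 * l ^+ 2 - c * k%:Z by rewrite -cE; ring.
  by rewrite jE !PoszM; ring.
- rewrite !card_prod !card_ord !Zp_cast //; lia.
by exists g => // u v; rewrite !Qd_edge //; apply: gE.
Qed.

Lemma mod_pm1 (k : nat) (x : int) :
  (x = 1 %[mod k%:Z])%Z \/ (x = -1 %[mod k%:Z])%Z <->
  exists2 e : int, e = 1 \/ e = -1 & (k%:Z %| x - e)%Z.
Proof.
split=> [[] /eqP|[e [] ->]]; rewrite ?eqz_mod_dvd.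
- by exists 1; [left|].
- by exists (-1); [right|].
- by rewrite -eqz_mod_dvd => /eqP; left.
- by rewrite -eqz_mod_dvd => /eqP; right.
Qed.

(** * From the arithmetic of m, n, r to the listed graphs *)

Lemma Qd_unstable_wilson m n (r : 'Z_n) : (1 < m)%N -> (1 < n)%N ->
  nontrivially_unstable (Qd m r) ->
  [\/ wilson1 m n r, wilson2' m n r |
     exists (h k : nat) (l : int),
      [/\ m = (2 * h)%N, n = (k * h)%N, odd h,
        (k%:Z %| 4 * l ^+ 2 - 1)%Z \/ (k%:Z %| 4 * l ^+ 2 + 1)%Z &
        (n%:Z %| (r : nat)%:Z - 4 * l * h%:Z)%Z /\
        ((1 < h)%N \/ ~~ (k%:Z %| 2 * l - 1)%Z /\ ~~ (k%:Z %| 2 * l + 1)%Z)]].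
Proof.
move=> m1 n1 /(Qd_unstable_only m1 n1)[nb tw twN [f tf nf]].
have gr := Qd_grid r m1 n1.
case: (twofold_classification gr nb tw twN tf nf) => [?|[h [k [l [mE nE oh kl rl]]]]|?];
  [by constructor 1| |by constructor 2].
constructor 3; exists h, k, l; split=> //; split=> //.
(* [wilson2] still admits h = 1 with 2 l = ±1 modulo k; there r = 4 l modulo n gives 2 b = ±2 a,
   which twin-freeness forbids. *)
have [h1|h1] := ltnP 1 h; first by left.
right; have {}h1 : h = 1%N by move: oh h1; clear; case: h => [|[|]].
have b2 (s : int) : (k%:Z %| 2 * l - s)%Z ->
    Qd_b m r + Qd_b m r = (Qd_a m r) *~ (2 * s) :> QdG m r.
  move=> /dvdzP[i iE]; have := grid_glue gr; rewrite [X in _ *+ X = _]mE h1 => E.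
  suff F : Qd_a m r *~ ((r : nat)%:Z - 2 * s) = 0 :> QdG m r.
    by abel_from (congr2 +%R E F).
  apply/(grid_order gr); have nk : n%:Z = k by rewrite nE h1 muln1.
  move: rl; rewrite nk h1 => /dvdzP[j jE].
  apply/dvdzP; exists (j + 2 * i).
  have -> : (j + 2 * i) * k%:Z = j * k%:Z + 2 * (i * k%:Z) by ring.
  by rewrite -jE -iE; ring.
split; apply/negP => kls.
- by apply: tw; rewrite (b2 1 kls); abel.
- by apply: twN; rewrite (b2 (-1)) ?opprK //; abel.
Qed.

Lemma Qd_wilson1_unstable (m k : nat) (r : 'Z_(4 * k)) :
  (1 < m)%N -> (0 < k)%N -> odd (m + k) -> r = k%:R \/ r = - k%:R ->
  nontrivially_unstable (Qd m r).
Proof.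
move=> m1 k0 omk rk; have k1 : (1 < 4 * k)%N by move: k0; clear; lia.
apply: Qd_unstable_if => //; apply: (wilson1_twofold (Qd_grid r m1 k1)).
exists k; split=> //; split=> //; case: rk => rk; [left|right].
  by apply/(Zp_intrP r k%:Z k1); rewrite rk -pmulrn.
by rewrite -[k%:Z]opprK; apply/(Zp_intrP r (- k%:Z) k1); rewrite rk mulrNz -pmulrn.
Qed.

Lemma Qd_wilson2_unstable (h k : nat) (l : int) :
  (0 < h)%N -> (1 < k * h)%N -> odd h ->
  (4 * l ^+ 2 = 1 %[mod k%:Z])%Z \/ (4 * l ^+ 2 = -1 %[mod k%:Z])%Z ->
  (1 < h)%N \/ (2 * l <> 1 %[mod k%:Z])%Z /\ (2 * l <> -1 %[mod k%:Z])%Z ->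
  nontrivially_unstable (Qd (2 * h) ((4 * l * h%:Z)%:~R : 'Z_(k * h))).
Proof.
move=> h0 kh1 oh /mod_pm1[e e1 ke] ht.
have h21 : (1 < 2 * h)%N by move: h0; clear; lia.
have rE := (Zp_intrP (4 * l * h%:Z)%:~R (4 * l * h%:Z) kh1).1 erefl.
have gr := Qd_grid (4 * l * h%:Z)%:~R h21 kh1.
apply: Qd_unstable_if => //.
have := wilson2_twofold gr erefl erefl oh e1 ke rE.
apply.
case: ht => [|[N1 N2]]; [by left|right].
have mo (s : int) : (2 * l <> s %[mod k%:Z])%Z -> ~~ (k%:Z %| 2 * l - s)%Z.
  by move=> N; apply/negP; rewrite -eqz_mod_dvd => /eqP.
by split; [apply: mo|have := mo (-1) N2; rewrite opprK].
Qed.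

Local Close Scope ring_scope.

Theorem theorem1p5 :
  (forall (m n : nat) (r : 'Z_n), 2 <= m -> 2 <= n ->
    nontrivially_unstable (Qd m r) <->
      (exists m' k : nat,
        [/\ 1 <= m', 1 <= k, 2 <= m' /\ 2 <= 4 * k, odd (m' + k)
          & isomorphic (Qd m r) (Qd m' (k%:R : 'Z_(4 * k))%R) \/
            isomorphic (Qd m r) (Qd m' (- k%:R : 'Z_(4 * k))%R)])
      \/
      (exists (m' k : nat) (l : int),
        [/\ [/\ 1 <= m', 1 <= k, 2 <= 2 * m' & 2 <= k * m'],
            odd m',
            (4 * l ^+ 2 = 1 %[mod k%:Z])%Z \/ (4 * l ^+ 2 = -1 %[mod k%:Z])%Z,
            1 < m' \/
            ((2 * l <> 1 %[mod k%:Z])%Z /\ (2 * l <> -1 %[mod k%:Z])%Z)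
          & isomorphic (Qd m r)
              (Qd (2 * m') ((4 * l * m'%:Z)%:~R : 'Z_(k * m'))%R) \/
            isomorphic (Qd m r)
              (Qd (2 * m') (- (4 * l * m'%:Z)%:~R : 'Z_(k * m'))%R)]))
  /\
  (forall (m k : nat) (l : int), 1 < m -> 1 <= k -> odd m ->
    (4 * l ^+ 2 = 1 %[mod k%:Z])%Z \/ (4 * l ^+ 2 = -1 %[mod k%:Z])%Z ->
    isomorphic (Qd (2 * m) ((4 * l * m%:Z)%:~R : 'Z_(k * m))%R)
               (Qd m ((2 * l * m%:Z)%:~R : 'Z_(2 * k * m))%R) /\
    isomorphic (Qd (2 * m) (- (4 * l * m%:Z)%:~R : 'Z_(k * m))%R)
               (Qd m (- (2 * l * m%:Z)%:~R : 'Z_(2 * k * m))%R)).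
Proof.
(* The sign of the third argument is absorbed by l -> -l, which preserves all conditions on l. *)
have opp_l (c : int) (d : nat) (l : int) (h : nat) :
    (- (c * l * h%:Z)%:~R = (c * - l * h%:Z)%:~R :> 'Z_d)%R.
  by rewrite -mulrNz; congr (_%:~R)%R; ring.
have sq_opp (l : int) : (4 * (- l) ^+ 2 = 4 * l ^+ 2)%R by ring.
have double_iso (m k : nat) (l : int) : 1 < m -> 1 <= k ->
    (4 * l ^+ 2 = 1 %[mod k%:Z])%Z \/ (4 * l ^+ 2 = -1 %[mod k%:Z])%Z ->
    isomorphic (Qd (2 * m) ((4 * l * m%:Z)%:~R : 'Z_(k * m))%R)
               (Qd m ((2 * l * m%:Z)%:~R : 'Z_(2 * k * m))%R).
  by move=> m1 k1 /mod_pm1[e e1 ke]; apply: Qd_double_iso ke.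
split=> [m n r m1 n1|m k l m1 k1 _ kl]; last first.
  split; first exact: double_iso.
  by rewrite !opp_l; apply: double_iso; rewrite ?sq_opp.
have conn := @Qd_connected m n r m1 n1.
split=> [/(Qd_unstable_wilson m1 n1)[|[k [l [om nE kl rl]]]|]|].
- case=> k [nE [omk rk]]; left; exists m, k; subst n.
  have k0 : 0 < k by move: n1; clear; case: k.
  split=> //; first exact: ltnW.
  case: rk => rk; [left|right].
    have -> : r = (k%:R)%R by apply/(Zp_intrP r k%:Z n1).
    exact: isomorphic_refl.
  have -> : r = (- k%:R)%R.
    by rewrite pmulrn -mulrNz; apply/(Zp_intrP r (- k%:Z)%R n1); rewrite opprK.
  exact: isomorphic_refl.
(* Here m > 1, so [double_iso] leads to the listed form, and the side condition holds by its first
   alternative. *)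
- right; exists m, k, l; subst n.
  have k0 : 0 < k by move: n1; clear; case: k.
  have km : 1 < k * m by apply: leq_trans m1 _; rewrite leq_pmull.
  have {}kl : (4 * l ^+ 2 = 1 %[mod k%:Z])%Z \/ (4 * l ^+ 2 = -1 %[mod k%:Z])%Z.
    by apply/mod_pm1; case: kl => kl; [exists 1%R; [left|]|exists (-1)%R; [right|rewrite opprK]].
  split=> //; [by split=> //; [exact: ltnW|move: m1; clear; lia]|by left|left].
  have -> : r = ((2 * l * m%:Z)%:~R)%R by apply/(Zp_intrP r (2 * l * m%:Z)%R n1).
  exact/isomorphic_sym/double_iso.
- case=> h [k [l [mE nE oh kl [rl ht]]]]; right; exists h, k, l; subst m n.
  have h0 : 0 < h by move: m1; clear; case: h.
  have k0 : 0 < k by move: n1; clear; case: k.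
  have {}kl : (4 * l ^+ 2 = 1 %[mod k%:Z])%Z \/ (4 * l ^+ 2 = -1 %[mod k%:Z])%Z.
    by apply/mod_pm1; case: kl => kl; [exists 1%R; [left|]|exists (-1)%R; [right|rewrite opprK]].
  split=> //; last first.
    left; have -> : r = ((4 * l * h%:Z)%:~R)%R by apply/(Zp_intrP r (4 * l * h%:Z)%R n1).
    exact: isomorphic_refl.
  case: ht => [|[N1 N2]]; [by left|right].
  split=> /eqP; rewrite eqz_mod_dvd; first exact/negP.
  by rewrite opprK; exact/negP.
case=> [[h [k [_ k0 [h1 _] ohk iso]]]|[h [k [l [[h0 k0 _ kh1] oh kl ht iso]]]]].
- case: iso => iso; apply: (nontrivially_unstable_iso iso conn);
    apply: Qd_wilson1_unstable => //; by [left|right].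
- case: iso => iso; apply: (nontrivially_unstable_iso iso conn).
    exact: Qd_wilson2_unstable.
  rewrite opp_l; apply: Qd_wilson2_unstable; rewrite ?sq_opp //.
  have mod_opp (s : int) : (2 * - l = s %[mod k%:Z] -> 2 * l = - s %[mod k%:Z])%Z.
    move/eqP; rewrite eqz_mod_dvd -rpredN => F; apply/eqP.
    by rewrite eqz_mod_dvd (_ : _ - _ = - (2 * - l - s))%R //; ring.
  case: ht => [|[N1 N2]]; [by left|right].
  by split=> /mod_opp; rewrite ?opprK.
Qed.
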